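(* An elliptic curve $E$ over a field $K$ of characteristic $2$ has a $K$-rational point of order $8$ if and only if there exists $t\in K\setminus\{0,1\}$ such that $E$ is $K$-isomorphic to the elliptic curve $$\mathbf{E}_{8,t}: y^2+xy=x^3+\left(\frac{t}{t^2+1}\right)^8.$$
   Context: The zero of the group law on $\mathbf{E}_{8,t}$ is its point at infinity $(0:1:0)$. $K$-isomorphic means isomorphic over $K$ as elliptic curves. *)

(* Defs.v *)
From mathcomp Require Import all_boot all_order all_algebra.
From mathcomp Require Import mpoly.

Set Implicit Arguments.
Unset Strict Implicit.
Unset Printing Implicit Defensive.

Import GRing.Theory.
Local Open Scope ring_scope.

(* y^2 + a1 xy + a3 y = x^3 + a2 x^2 + a4 x + a6 *)
Record weierstrass (K : fieldType) :=
  Weierstrass { a1 : K; a2 : K; a3 : K; a4 : K; a6 : K }.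

Definition base_change (K L : fieldType) (iota : {rmorphism K -> L})
    (W : weierstrass K) : weierstrass L :=
  Weierstrass (iota (a1 W)) (iota (a2 W)) (iota (a3 W))
              (iota (a4 W)) (iota (a6 W)).

Definition affine_eq (K : fieldType) (W : weierstrass K) (x y : K) : Prop :=
  y ^+ 2 + a1 W * x * y + a3 W * y
  = x ^+ 3 + a2 W * x ^+ 2 + a4 W * x + a6 W.

(* The Jacobian criterion at all geometric points: the two disjuncts are the
   partial derivatives of the affine equation.  The point at infinity of a
   Weierstrass cubic is always smooth. *)
Definition is_elliptic (K : fieldType) (W : weierstrass K) : Prop :=
  forall (L : fieldType) (iota : {rmorphism K -> L}) (x y : L),
    let WL := base_change iota W in
    affine_eq WL x y ->
    a1 WL * y - (3%:R * x ^+ 2 + 2%:R * a2 WL * x + a4 WL) != 0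
    \/ 2%:R * y + a1 WL * x + a3 WL != 0.

Inductive point (K : fieldType) := Infinity | Affine of K & K.
Arguments Infinity {K}.

Definition on_curve (K : fieldType) (W : weierstrass K) (P : point K) : Prop :=
  if P is Affine x y then affine_eq W x y else True.

(* (0 : 1 : 0) is the only point at infinity of a Weierstrass cubic. *)
Definition coords (K : fieldType) (P : point K) : 3.-tuple K :=
  if P is Affine x y then [tuple x; y; 1] else [tuple 0; 1; 0].

(* Chord and tangent law; the first test is P = - Q. *)
Definition add (K : fieldType) (W : weierstrass K) (P Q : point K) : point K :=
  match P, Q with
  | Infinity, _ => Q
  | _, Infinity => P
  | Affine x1 y1, Affine x2 y2 =>
      if (x1 == x2) && (y2 == - y1 - a1 W * x1 - a3 W) then Infinity
      else
        let l := if x1 == x2 then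
                   (3%:R * x1 ^+ 2 + 2%:R * a2 W * x1 + a4 W - a1 W * y1)
                   / (2%:R * y1 + a1 W * x1 + a3 W)
                 else (y2 - y1) / (x2 - x1) in
        let x3 := l ^+ 2 + a1 W * l - a2 W - x1 - x2 in
        Affine x3 (- (y1 + l * (x3 - x1)) - a1 W * x3 - a3 W)
  end.

Definition mulp (K : fieldType) (W : weierstrass K) (n : nat) (P : point K) :
    point K :=
  iter n (add W P) Infinity.

Definition has_order (K : fieldType) (W : weierstrass K) (P : point K)
    (n : nat) : Prop :=
  [/\ (0 < n)%N, mulp W n P = Infinity
    & forall m : nat, (0 < m < n)%N -> mulp W m P <> Infinity].

(* A regular map between plane projective curves over K is given by finitely
   many triples of forms over K; the forms in a triple have the same degree. *)
Definition charts (K : fieldType) := seq (3.-tuple {mpoly K[3]}).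

Definition homogeneous (K : fieldType) (Phi : charts K) : Prop :=
  forall F, F \in Phi -> exists d : nat, forall i, tnth F i \is d.-homog.

(* Every triple of Phi that does not vanish at P takes the value Q at P, and
   some triple of Phi does not vanish at P. *)
Definition sends (K L : fieldType) (iota : {rmorphism K -> L}) (Phi : charts K)
    (P Q : point L) : Prop :=
  let value F i := mmap iota (tnth (coords P)) (tnth F i) in
  (forall F, F \in Phi ->
     exists c : L, forall i, value F i = c * tnth (coords Q) i)
  /\ (exists2 F, F \in Phi & exists i, value F i != 0).

(* Regularity, compatibility of the triples and the fact that the image lies
   in the target are tested at the points over all extension fields of K;
   rational points over K alone would not suffice. *)
Definition is_morphism (K : fieldType) (W W' : weierstrass K) (Phi : charts K) :
    Prop :=
  homogeneous Phi
  /\ forall (L : fieldType) (iota : {rmorphism K -> L}) (P : point L),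
       on_curve (base_change iota W) P ->
       exists2 Q, on_curve (base_change iota W') Q & sends iota Phi P Q.

(* Isomorphism over K as elliptic curves: mutually inverse morphisms of
   projective curves over K that map the origin to the origin. *)
Definition isomorphic (K : fieldType) (W W' : weierstrass K) : Prop :=
  exists Phi Psi : charts K,
    [/\ is_morphism W W' Phi, is_morphism W' W Psi,
        sends idfun Phi Infinity Infinity
      & forall (L : fieldType) (iota : {rmorphism K -> L}) (P Q : point L),
          on_curve (base_change iota W) P -> on_curve (base_change iota W') Q ->
          (sends iota Phi P Q <-> sends iota Psi Q P)].

Definition E8 (K : fieldType) (t : K) : weierstrass K :=
  Weierstrass 1 0 0 0 ((t / (t ^+ 2 + 1)) ^+ 8).

(* Main.v *)
(* A morphism between Weierstrass curves that fixes the point at infinity and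
   has an inverse is given on the affine curve by two elements x', y' of the
   coordinate ring (Nullstellensatz applied to the charts), and these generate
   the coordinate ring; comparing pole orders at infinity, x' and y' have poles
   of order 2 and 3, so every isomorphism is a change of variables
   (u^2 x + r, u^3 y + s u^2 x + t), which preserves the group law.

   In characteristic 2 a curve with a point of order 8 is ordinary and becomes
   y^2 + x y = x^3 + a x^2 + b.  Let P = (x, x (l + x)) and X = x(2 P), so that
   X = l^2 + l + a.  The condition x(4 P) = 0 reads X^2 + x^4/X^2 + x^2/X = 0.
   It gives a = s^2 + s for s = X + x^2/X + l, whence a can be removed, and
   b = w^8, w = n^2 + n for w = (X + x)^2/x, n = X + x^2/X + w; then
   w = t/(t^2 + 1) for t = 1/n + 1.  Conversely, for w = m^2 + m the point with
   x = w m^2, l = m^2 on y^2 + x y = x^3 + w^8 has order 8. *)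
From HB Require Import structures.
From mathcomp Require Import all_boot all_order all_algebra.
From mathcomp Require Import mpoly ring zify.
From mathcomp Require Import boolp classical_sets.
Require Import Defs.

Set Implicit Arguments.
Unset Strict Implicit.
Unset Printing Implicit Defensive.

Import GRing.Theory.
Local Open Scope ring_scope.

(** * The chord and tangent law *)

Section LinearCombination.
Variable R : comPzRingType.

(** Exhibits a goal as a multiple of a known equation and leaves a [ring] identity. Applied to
    [2 = 0], this also carries out the computations in characteristic 2. *)
Lemma lincomb1 (k a b c d : R) : a = b -> c - d = k * (a - b) -> c = d.
Proof. by move=> -> /eqP; rewrite subrr mulr0 subr_eq0 => /eqP. Qed.

Lemma lincomb2 (k k' a b a' b' c d : R) :
  a = b -> a' = b' -> c - d = k * (a - b) + k' * (a' - b') -> c = d.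
Proof. by move=> -> -> /eqP; rewrite !subrr !mulr0 addr0 subr_eq0 => /eqP. Qed.

End LinearCombination.

Section ChordTangent.
Variables (K : fieldType) (W : weierstrass K).

Definition opp (P : point K) : point K :=
  if P is Affine x y then Affine x (- y - a1 W * x - a3 W) else Infinity.

(* The second equation determines the slope of the tangent when x1 = x2; for
   points of the curve it follows from the first one when x1 != x2. *)
Definition is_slope (x1 y1 x2 y2 l : K) : Prop :=
  y2 - y1 = l * (x2 - x1) /\
  l * (y1 + y2 + a1 W * x1 + a3 W)
  = x1 ^+ 2 + x1 * x2 + x2 ^+ 2 + a2 W * (x1 + x2) + a4 W - a1 W * y2.

Definition add_slope (l x1 y1 x2 : K) : point K :=
  let x3 := l ^+ 2 + a1 W * l - a2 W - x1 - x2 in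
  Affine x3 (- (y1 + l * (x3 - x1)) - a1 W * x3 - a3 W).

(** What [is_elliptic] says at the points over [K] itself, with the identity as embedding. *)
Definition nonsingular : Prop := forall x y : K, affine_eq W x y ->
  a1 W * y - (3%:R * x ^+ 2 + 2%:R * a2 W * x + a4 W) != 0
  \/ 2%:R * y + a1 W * x + a3 W != 0.

Lemma oppK : involutive opp.
Proof. by case=> // x y /=; congr Affine; ring. Qed.

Lemma on_curve_opp P : on_curve W P -> on_curve W (opp P).
Proof.
case: P => // x y /= E; rewrite /affine_eq.
by apply: (lincomb1 (k := 1) E); ring.
Qed.

(** The difference of the two equations factors: the quadratic in y has the roots [y] and
    [- y - a1 W * x - a3 W]. *)
Lemma affine_eq_same_x x y y' : affine_eq W x y -> affine_eq W x y' ->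
  y' != - y - a1 W * x - a3 W -> y' = y.
Proof.
move=> E E' ne; apply/eqP; rewrite -subr_eq0.
have /eqP : (y' - y) * (y' - (- y - a1 W * x - a3 W)) = 0.
  by apply: (lincomb2 (k := 1) (k' := -1) E' E); ring.
by rewrite mulf_eq0 (subr_eq0 y' (- y - _ - _)) (negPf ne) orbF.
Qed.

Lemma addP x1 y1 x2 y2 :
    affine_eq W x1 y1 -> affine_eq W x2 y2 ->
    Affine x2 y2 <> opp (Affine x1 y1) ->
  exists2 l, is_slope x1 y1 x2 y2 l
    & add W (Affine x1 y1) (Affine x2 y2) = add_slope l x1 y1 x2.
Proof.
move=> E1 E2 nopp; rewrite /add.
case: (eqVneq x1 x2) => [eqx|nex] /=.
  move: E2 nopp; rewrite -eqx => E2 nopp.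
  have ne : y2 != - y1 - a1 W * x1 - a3 W by apply/eqP => e; apply: nopp; rewrite e.
  have e2 := affine_eq_same_x E1 E2 ne; subst y2; rewrite (negPf ne).
  have nz : 2%:R * y1 + a1 W * x1 + a3 W != 0.
    by apply: contra ne => /eqP z; apply/eqP; apply: (lincomb1 (k := 1) z); ring.
  eexists; last by rewrite /add_slope; reflexivity.
  rewrite /is_slope; split; first by ring.
  rewrite (_ : y1 + y1 + a1 W * x1 + a3 W = 2%:R * y1 + a1 W * x1 + a3 W); last by ring.
  by rewrite mulfVK //; ring.
have nz : x2 - x1 != 0 by rewrite subr_eq0 eq_sym.
eexists; last by rewrite /add_slope; reflexivity.
split; first by rewrite mulfVK.
(* Multiplied by [x2 - x1], the second slope equation is the difference of the two curve
   equations. *)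
apply: (mulfI nz); rewrite mulrA (mulrC (x2 - x1)) mulfVK //.
by apply: (lincomb2 (k := 1) (k' := -1) E2 E1); ring.
Qed.

Lemma is_slope_uniq x1 y1 x2 y2 l l' :
    affine_eq W x1 y1 -> affine_eq W x2 y2 ->
    Affine x2 y2 <> opp (Affine x1 y1) ->
  is_slope x1 y1 x2 y2 l -> is_slope x1 y1 x2 y2 l' -> l = l'.
Proof.
move=> E1 E2 nopp [A B] [A' B']; case: (eqVneq x1 x2) => [eqx|nex].
  move: E2 B B' nopp; rewrite -eqx => E2 B B' nopp.
  have ne : y2 != - y1 - a1 W * x1 - a3 W by apply/eqP => e; apply: nopp; rewrite e.
  have nz : y1 + y2 + a1 W * x1 + a3 W != 0.
    by apply: contra ne => /eqP z; apply/eqP; apply: (lincomb1 (k := 1) z); ring.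
  by apply: (mulIf nz); rewrite B B'.
have nz : x2 - x1 != 0 by rewrite subr_eq0 eq_sym.
by apply: (mulIf nz); rewrite -A -A'.
Qed.

Lemma add_slopeE x1 y1 x2 y2 l :
    affine_eq W x1 y1 -> affine_eq W x2 y2 ->
    Affine x2 y2 <> opp (Affine x1 y1) -> is_slope x1 y1 x2 y2 l ->
  add W (Affine x1 y1) (Affine x2 y2) = add_slope l x1 y1 x2.
Proof.
move=> E1 E2 nopp Sl; have [l' Sl' ->] := addP E1 E2 nopp.
by rewrite (is_slope_uniq E1 E2 nopp Sl Sl').
Qed.

Lemma add_opp x y : add W (Affine x y) (opp (Affine x y)) = Infinity.
Proof. by rewrite /= !eqxx. Qed.

(** On the line through the points, the curve equation minus its instance at [x1] is [x - x1] times
    a quadratic in x. The second slope equation says that [x2] is a root of this quadratic, and [x3]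
    is the other root. *)
Lemma on_curve_add_slope x1 y1 x2 y2 l : affine_eq W x1 y1 ->
  is_slope x1 y1 x2 y2 l -> on_curve W (add_slope l x1 y1 x2).
Proof.
move=> E1 [A B]; rewrite /add_slope /= /affine_eq.
have {}A : y2 = y1 + l * (x2 - x1) by rewrite -A; ring.
subst y2; set x3 := l ^+ 2 + _ - _ - _ - _.
apply: (lincomb2 (k := 1) (k' := x3 - x1) E1 B); rewrite /x3; ring.
Qed.

Lemma on_curve_add P Q : on_curve W P -> on_curve W Q -> on_curve W (add W P Q).
Proof.
case: P Q => [|x y] [|x' y'] // E E'.
have [e|ne] := pselect (Affine x' y' = opp (Affine x y)).
  by rewrite e add_opp.
by have [l Sl ->] := addP E E' ne; apply: on_curve_add_slope Sl.
Qed.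

Lemma on_curve_mulp n P : on_curve W P -> on_curve W (mulp W n P).
Proof. by move=> oP; elim: n => //= n IH; apply: on_curve_add. Qed.

Lemma opp_add P Q : on_curve W P -> on_curve W Q ->
  opp (add W P Q) = add W (opp P) (opp Q).
Proof.
case: P Q => [|x y] [|x' y'] // E E'.
have [e|ne] := pselect (Affine x' y' = opp (Affine x y)).
  by rewrite e !add_opp.
have [l [A B] ->] := addP E E' ne.
(* Negation turns a line of slope [l] into one of slope [- l - a1 W]. *)
have := @add_slopeE x (- y - a1 W * x - a3 W) x' (- y' - a1 W * x' - a3 W)
  (- l - a1 W) (on_curve_opp (P := Affine x y) E)
  (on_curve_opp (P := Affine x' y') E').
move=> /= -> //.
- by rewrite /add_slope /=; congr Affine; ring.
- case=> ex ey; apply: ne; rewrite /= ex; congr Affine.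
  by rewrite ex in ey; apply: (lincomb1 (k := -1) ey); ring.
split; first by apply: (lincomb1 (k := -1) A); ring.
by apply: (lincomb2 (k := 1) (k' := - a1 W) B A); ring.
Qed.

(* The points P, R and -(P + R) are collinear, so negating the line through
   them gives the line through -P and P + R. *)
Lemma add_oppK P R : nonsingular -> on_curve W P -> on_curve W R ->
  add W (opp P) (add W P R) = R.
Proof.
move=> ns; case: P R => [|x1 y1] [|x2 y2] // E1 E2.
  by rewrite -{2}(oppK (Affine x1 y1)) add_opp.
have [e|ne] := pselect (Affine x2 y2 = opp (Affine x1 y1)).
  by rewrite e add_opp.
have [l Sl ->] := addP E1 E2 ne.
have on3 := on_curve_add_slope E1 Sl; move: Sl on3 => [A B].
have {}A : y2 = y1 + l * (x2 - x1) by rewrite -A; ring.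
subst y2; rewrite /add_slope /=; set x3 := l ^+ 2 + _ - _ - _ - _.
set y3 := - (y1 + _) - _ - _ => on3.
have S3 : is_slope x1 (- y1 - a1 W * x1 - a3 W) x3 y3 (- l - a1 W).
  by split; [|apply: (lincomb1 (k := 1) B)]; rewrite /y3 /x3; ring.
rewrite [LHS](add_slopeE (on_curve_opp (P := Affine x1 y1) E1) on3 _ S3).
  by rewrite /add_slope /x3; congr Affine; ring.
(* In the remaining case P + R = P. Then P = -P makes one partial derivative vanish at P, and the
   second slope equation makes the other vanish, so P is singular. *)
rewrite -[opp _]/(opp (opp (Affine x1 y1))) oppK => -[e3x e3y].
move: S3 => [_]; rewrite e3x e3y => B3.
have z : 2%:R * y1 + a1 W * x1 + a3 W = 0.
  by move: e3y; rewrite /y3 e3x => e3y; apply: (lincomb1 (k := -1) e3y); ring.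
case: (ns _ _ E1) => /eqP; apply => //.
by apply: (lincomb1 (k := 1) B3); ring.
Qed.

(** Induction on [k]: [add_oppK] takes one P away on the left, and [opp_add] adds it inside the
    negation on the right. This leads from 8P = 0 to 4P = -4P, and back. *)
Lemma mulp_reflect P m n k : nonsingular -> on_curve W P ->
  mulp W n P = opp (mulp W m P) -> (k <= n)%N ->
  mulp W (n - k) P = opp (mulp W (m + k) P).
Proof.
move=> ns oP enm; elim: k => [|k IH] lekn; first by rewrite subn0 addn0.
have oM j : on_curve W (mulp W j P) by apply: on_curve_mulp.
rewrite -[LHS](add_oppK ns oP (oM _)) addnS.
rewrite -[add W P _]/(mulp W (n - k.+1).+1 P) -subSn // subSS.
by rewrite (IH (ltnW lekn)) -opp_add.
Qed.

End ChordTangent.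

(** * Changes of variables *)

Section ChangeOfVariables.
Variable K : fieldType.
Implicit Types (V : weierstrass K) (P : point K).

(* The curve whose point (u^2 x + r, u^3 y + s u^2 x + t) corresponds to the
   point (x, y) of V. *)
Definition transform (u r s t : K) V : weierstrass K :=
  let b1 := u * a1 V - 2%:R * s in
  let b2 := u ^+ 2 * a2 V + s * b1 - 3%:R * r + s ^+ 2 in
  let b3 := u ^+ 3 * a3 V - r * b1 - 2%:R * t in
  let b4 := u ^+ 4 * a4 V + s * b3 - 2%:R * r * b2 + (t + r * s) * b1
            - 3%:R * r ^+ 2 + 2%:R * s * t in
  let b6 := u ^+ 6 * a6 V - r * b4 - r ^+ 2 * b2 - r ^+ 3 + t * b3 + t ^+ 2
            + r * t * b1 in
  Weierstrass b1 b2 b3 b4 b6.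

Definition transform_pt (u r s t : K) P : point K :=
  if P is Affine x y then Affine (u ^+ 2 * x + r) (u ^+ 3 * y + s * u ^+ 2 * x + t)
  else Infinity.

Definition untransform_pt (u r s t : K) P : point K :=
  if P is Affine x y then
    Affine ((x - r) / u ^+ 2) ((y - s * (x - r) - t) / u ^+ 3)
  else Infinity.

Variables (u r s t : K).
Hypothesis u0 : u != 0.
Let T := transform u r s t.
Let f := transform_pt u r s t.
Let g := untransform_pt u r s t.

Lemma untransform_ptK : cancel g f.
Proof. by case=> //= x y; congr Affine; field. Qed.

Lemma transform_ptK : cancel f g.
Proof. by case=> //= x y; congr Affine; field. Qed.

Lemma on_curve_transform V P : on_curve (T V) (f P) <-> on_curve V P.
Proof.
case: P => //= x y; rewrite /affine_eq /=; split=> E.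
  have u6 : u ^+ 6 != 0 by rewrite expf_neq0.
  by apply: (mulfI u6); apply: (lincomb1 (k := 1) E); ring.
by apply: (lincomb1 (k := u ^+ 6) E); ring.
Qed.

Lemma transform_opp V P : f (opp V P) = opp (T V) (f P).
Proof. by case: P => //= x y; congr Affine; ring. Qed.

Lemma transform_add V P Q : on_curve V P -> on_curve V Q ->
  f (add V P Q) = add (T V) (f P) (f Q).
Proof.
case: P Q => [|x y] [|x' y'] // E E'.
have [e|ne] := pselect (Affine x' y' = opp V (Affine x y)).
  by rewrite e !transform_opp !add_opp.
have [l [A B] ->] := addP E E' ne.
have Tne : f (Affine x' y') <> opp (T V) (f (Affine x y)).
  by rewrite -transform_opp => /(can_inj transform_ptK).
have TE := (on_curve_transform V (Affine x y)).2 E.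
have TE' := (on_curve_transform V (Affine x' y')).2 E'.
(* The change of variables sends a line of slope [l] to one of slope [u * l + s]. *)
rewrite [RHS](add_slopeE (l := u * l + s) TE TE' Tne).
  by rewrite /add_slope /=; congr Affine; ring.
split; first by apply: (lincomb1 (k := u ^+ 3) A); ring.
by apply: (lincomb2 (k := u ^+ 4) (k' := - s * u ^+ 3) B A); rewrite /T /=; ring.
Qed.

Lemma transform_mulp V P n : on_curve V P -> f (mulp V n P) = mulp (T V) n (f P).
Proof.
move=> oP; elim: n => //= n IH; rewrite transform_add ?IH //.
exact: on_curve_mulp.
Qed.

Lemma transform_has_order V P n : on_curve V P ->
  has_order (T V) (f P) n <-> has_order V P n.
Proof.
move=> oP; have e k : mulp (T V) k (f P) = Infinity <-> mulp V k P = Infinity.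
  rewrite -transform_mulp //; split=> [|-> //].
  by rewrite -[RHS]/(f Infinity) => /(can_inj transform_ptK).
by split=> -[n0 /e nP lt]; split=> // m /lt h /e.
Qed.

End ChangeOfVariables.

(** * Changes of variables as isomorphisms of projective curves *)

Section Sends.
Variables (K L : fieldType) (iota : {rmorphism K -> L}).

(** [coords] picks one representative of each projective point, so nonzero proportional triples
    belong to the same point. *)
Lemma coords_inj (P Q : point L) (c d : L) (i : 'I_3) :
  c * tnth (coords P) i != 0 ->
  (forall i, c * tnth (coords P) i = d * tnth (coords Q) i) -> P = Q.
Proof.
move=> nz e; have [c0 d0] : c != 0 /\ d != 0.
  have := nz; rewrite mulf_eq0 negb_or => /andP[-> _].
  by move: nz; rewrite e mulf_eq0 negb_or => /andP[-> _].
have := (e ord0, e (lift ord0 ord0), e ord_max).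
case: P Q {nz e} => [|x y] [|x' y'] //=; rewrite /tnth /= ?mulr1 ?mulr0.
- by case=> _ d1; rewrite -d1 eqxx in d0.
- by case=> _ c1; rewrite c1 eqxx in c0.
by case=> -[ex ey] cd; rewrite -cd in ex ey; rewrite (mulfI c0 ex) (mulfI c0 ey).
Qed.

Lemma sends_uniq (Phi : charts K) (P Q Q' : point L) :
  sends iota Phi P Q -> sends iota Phi P Q' -> Q = Q'.
Proof.
move=> [v [F FPhi [i nz]]] [v' _]; have [c e] := v F FPhi.
have [d e'] := v' F FPhi; rewrite e in nz.
by apply: (coords_inj nz) => j; rewrite -e e'.
Qed.

End Sends.

Section LinearCharts.
Variable K : fieldType.

(** The homogenization of [linear_pt]. For [ga != 0] this single triple vanishes at no point of the
    curve: at infinity its value is (0, ga, 0). *)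
Definition linear_chart (al be ga de ep : K) : charts K :=
  let X0 : {mpoly K[3]} := mpolyX K U_(inord 0) in
  let X1 : {mpoly K[3]} := mpolyX K U_(inord 1) in
  let X2 : {mpoly K[3]} := mpolyX K U_(inord 2) in
  [:: [tuple al *: X0 + be *: X2; ga *: X1 + de *: X0 + ep *: X2; X2]].

Definition linear_pt (al be ga de ep : K) (P : point K) : point K :=
  if P is Affine x y then Affine (al * x + be) (ga * y + de * x + ep)
  else Infinity.

Lemma linear_chart_homogeneous al be ga de ep :
  homogeneous (linear_chart al be ga de ep).
Proof.
have hX (i : 'I_3) : (mpolyX K U_(i) : {mpoly K[3]}) \is 1.-homog.
  by rewrite dhomogX /= mdeg1.
move=> F; rewrite inE => /eqP ->; exists 1%N => i.
rewrite (tnth_nth 0); case: i => -[|[|[|//]]] _ /=.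
- by rewrite rpredD ?dhomogZ.
- by rewrite !rpredD ?dhomogZ.
- exact: hX.
Qed.

End LinearCharts.

Lemma linear_sends (K L : fieldType) (iota : {rmorphism K -> L})
    (al be ga de ep : K) (P : point L) : ga != 0 ->
  sends iota (linear_chart al be ga de ep) P
    (linear_pt (iota al) (iota be) (iota ga) (iota de) (iota ep) P).
Proof.
move=> ga0; set F := head [tuple 0; 0; 0] (linear_chart al be ga de ep).
have vE (i : 'I_3) : mmap iota (tnth (coords P)) (tnth F i)
    = (if P is Infinity then iota ga else 1)
      * tnth (coords (linear_pt (iota al) (iota be) (iota ga) (iota de) (iota ep) P)) i.
  rewrite !(tnth_nth 0); case: i => -[|[|[|//]]] lti /=;
  rewrite ?mmapD ?mmapZ ?mmapX ?mmap1U !(tnth_nth 0) !inordK //;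
  case: P => [|x y] /=; ring.
split; first by move=> G; rewrite inE => /eqP ->; eexists; apply: vE.
exists F; first by rewrite inE.
case: P vE => [|x y] vE.
  by exists (inord 1); rewrite vE (tnth_nth 0) inordK //= mulr1 fmorph_eq0.
by exists (inord 2); rewrite vE (tnth_nth 0) inordK //= mulr1 oner_neq0.
Qed.

Lemma base_change_transform (K L : fieldType) (iota : {rmorphism K -> L}) u r s t V :
  base_change iota (transform u r s t V)
  = transform (iota u) (iota r) (iota s) (iota t) (base_change iota V).
Proof. by rewrite /base_change /transform /=; congr Weierstrass; ring. Qed.

Lemma isomorphic_transform (K : fieldType) (u r s t : K) V : u != 0 ->
  isomorphic (transform u r s t V) V.
Proof.
move=> u0; have u3 : u ^- 3 != 0 by rewrite invr_eq0 expf_neq0.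
have u3' : u ^+ 3 != 0 by rewrite expf_neq0.
pose Phi := linear_chart (u ^- 2) (- r / u ^+ 2) (u ^- 3) (- s / u ^+ 3)
  ((s * r - t) / u ^+ 3).
pose Psi := linear_chart (u ^+ 2) r (u ^+ 3) (s * u ^+ 2) t.
have sPsi (L : fieldType) (iota : {rmorphism K -> L}) P :
    sends iota Psi P (transform_pt (iota u) (iota r) (iota s) (iota t) P).
  have := linear_sends iota (u ^+ 2) r (s * u ^+ 2) t P u3'; congr sends.
  by case: P => //= x y; congr Affine; rewrite !(rmorphM, rmorphXn).
have sPhi (L : fieldType) (iota : {rmorphism K -> L}) P :
    sends iota Phi P (untransform_pt (iota u) (iota r) (iota s) (iota t) P).
  have := linear_sends iota (u ^- 2) (- r / u ^+ 2) (- s / u ^+ 3)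
    ((s * r - t) / u ^+ 3) P u3; congr sends.
  have iu0 : iota u != 0 by rewrite fmorph_eq0.
  case: P => //= x y; congr Affine;
  by rewrite !(rmorphM, rmorphB, rmorphN, fmorphV, rmorphXn); field.
exists Phi, Psi; split.
- split=> [|L iota P]; first exact: linear_chart_homogeneous.
  have iu0 : iota u != 0 by rewrite fmorph_eq0.
  rewrite base_change_transform => oP; eexists; last exact: sPhi.
  by apply/(on_curve_transform (iota r) (iota s) (iota t) iu0); rewrite untransform_ptK.
- split=> [|L iota P oP]; first exact: linear_chart_homogeneous.
  have iu0 : iota u != 0 by rewrite fmorph_eq0.
  eexists; last exact: sPsi.
  by rewrite base_change_transform; apply/on_curve_transform.
- exact: (sPhi K idfun).
move=> L iota P Q oP oQ; have iu0 : iota u != 0 by rewrite fmorph_eq0.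
split=> h.
  rewrite (sends_uniq h (sPhi L iota P)).
  by rewrite -{2}(untransform_ptK (iota r) (iota s) (iota t) iu0 P); apply: sPsi.
rewrite (sends_uniq h (sPsi L iota Q)).
by rewrite -{2}(transform_ptK (iota r) (iota s) (iota t) iu0 Q); apply: sPhi.
Qed.

(** * Prime ideals and residue fields *)

Section PrimeIdealResidueField.
Variables (R : comNzRingType) (J : set R).
Hypothesis J0 : J 0.
Hypothesis JD : forall a x y, J x -> J y -> J (a * x + y).
Hypothesis J1 : ~ J 1.
Hypothesis Jprime : forall x y, J (x * y) -> J x \/ J y.

Definition in_ideal : {pred R} := fun x => `[< J x >].

Fact in_ideal_closed : idealr_closed in_ideal.
Proof.
split; first exact/asboolP.
  by apply/asboolP.
by move=> a x y /asboolP Jx /asboolP Jy; apply/asboolP; apply: JD.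
Qed.

Fact in_ideal_prime : prime_idealr_closed in_ideal.
Proof.
by move=> x y /asboolP /Jprime[] Jz; apply/orP; [left|right]; apply/asboolP.
Qed.

HB.instance Definition _ := isIdealr.Build R in_ideal in_ideal_closed.
HB.instance Definition _ := isPrimeIdealrClosed.Build R in_ideal in_ideal_prime.

Definition residue_domain := Quotient.quot (in_ideal : prime_idealr R).
HB.instance Definition _ := GRing.ComNzRing.on residue_domain.

(** The fraction field is formed from an integral domain with a partial inverse; here the inverse is
    chosen classically. *)
Definition residue_unit : {pred residue_domain} :=
  fun x => `[< exists y, y * x = 1 >].
Definition residue_inv (x : residue_domain) : residue_domain :=
  if pselect (exists y, y * x = 1) is left h then projT1 (cid h) else x.

Fact residue_mulVx : {in residue_unit, left_inverse 1 residue_inv *%R}.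
Proof.
move=> x /asboolP h; rewrite /residue_inv.
by case: pselect => // h'; case: cid.
Qed.

Fact residue_unitPl x y : y * x = 1 -> residue_unit x.
Proof. by move=> h; apply/asboolP; exists y. Qed.

Fact residue_inv_out : {in [predC residue_unit], residue_inv =1 id}.
Proof.
by move=> x /asboolPn h; rewrite /residue_inv; case: pselect.
Qed.

HB.instance Definition _ := GRing.ComNzRing_hasMulInverse.Build residue_domain
  residue_mulVx residue_unitPl residue_inv_out.

Fact residue_integral (x y : residue_domain) : x * y = 0 -> (x == 0) || (y == 0).
Proof. exact: Quotient.rquot_IdomainAxiom. Qed.

HB.instance Definition _ := GRing.ComUnitRing_isIntegral.Build residue_domain
  residue_integral.

(** The field is the fraction field of R/J, into which R/J embeds. *)
Lemma residue_field :
  exists (L : fieldType) (f : {rmorphism R -> L}), forall x, f x = 0 <-> J x.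
Proof.
pose p : R -> residue_domain := \pi_(Quotient.quot (in_ideal : prime_idealr R))%qT.
have pZ : zmod_morphism p by move=> x y; exact: rmorphB.
have pM : monoid_morphism p by split=> [|x y]; [exact: rmorph1|exact: rmorphM].
pose pz := GRing.isZmodMorphism.Build _ _ p pZ.
pose pm := GRing.isMonoidMorphism.Build _ _ p pM.
pose pr : {rmorphism R -> residue_domain} := HB.pack p pz pm.
exists {fraction residue_domain}, (@tofrac residue_domain \o pr) => x.
have pE : (p x == p 0) = (x - 0 \in (in_ideal : prime_idealr R)).
  by rewrite Quotient.idealrBE.
have -> : (@tofrac residue_domain \o pr) x = 0 <-> p x == p 0.
  rewrite (rmorph0 pr : p 0 = 0) -[p x == 0](tofrac_eq0 (p x)).
  by split=> /eqP.
by rewrite pE subr0; split=> /asboolP.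
Qed.

End PrimeIdealResidueField.

(* Krull's lemma: an ideal maximal among those disjoint from S is prime. *)
Lemma field_avoiding (R : comNzRingType) (I S : set R) :
    I 0 -> (forall a x y, I x -> I y -> I (a * x + y)) ->
    S 1 -> (forall x y, S x -> S y -> S (x * y)) ->
    (forall x, I x -> ~ S x) ->
  exists (L : fieldType) (f : {rmorphism R -> L}),
    (forall x, I x -> f x = 0) /\ (forall x, S x -> f x <> 0).
Proof.
move=> I0 ID S1 SM IS.
pose good (J : set R) := [/\ (I `<=` J)%classic,
  (forall a x y, J x -> J y -> J (a * x + y)) & forall x, J x -> ~ S x].
have [|J [PJ Jmax]] := @Zorn_bigcup R (fun J => J = set0 \/ good J).
  move=> F FP Ftot.
  have [[X [FX gX]]|nog] := pselect (exists X, F X /\ good X); last first.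
    left; apply/seteqP; split=> // x [X FX Xx].
    by case: (FP _ FX) => [X0|gX]; [rewrite X0 in Xx|case: nog; exists X].
  have goodF Y y : F Y -> Y y -> good Y.
    by move=> FY Yy; case: (FP _ FY) => // Y0; rewrite Y0 in Yy.
  right; split=> [x Ix|a x y [Y FY Yx] [Z FZ Zy]|x [Y FY Yx]].
  - by exists X => //; case: gX => + _ _; apply.
  - have [YZ|ZY] := Ftot _ _ FY FZ.
      by exists Z => //; have [_ + _] := goodF _ _ FZ Zy; apply => //; apply: YZ.
    by exists Y => //; have [_ + _] := goodF _ _ FY Yx; apply => //; apply: ZY.
  - by have [_ _ +] := goodF _ _ FY Yx; apply.
have gJ : good J.
  case: PJ => // J0; exfalso; apply: (Jmax I); last by right; split.
  by rewrite J0; split=> // /(_ 0 I0).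
have [IJ JD JS] := gJ.
have J0 : J 0 by apply: IJ.
have J1 : ~ J 1 by move=> /JS; apply.
(* By maximality the ideal generated by [J] and [z] meets [S]. *)
have enlarge z : ~ J z -> exists2 s, S s & exists2 x, J x & exists a, s = x + a * z.
  move=> Jz; apply: contrapT => none.
  apply: (Jmax [set w | exists2 x, J x & exists a, w = x + a * z]%classic).
    split=> [w Jw|/(_ z)]; first by exists w => //; exists 0; rewrite mul0r addr0.
    by apply/not_implyP; split=> //; exists 0 => //; exists 1; rewrite mul1r add0r.
  right; split=> [w /IJ Jw|a x y [x' Jx [b ->]] [y' Jy [c ->]]|w h Sw].
  - by exists w => //; exists 0; rewrite mul0r addr0.
  - by exists (a * x' + y'); [apply: JD|exists (a * b + c); ring].
  - by apply: none; exists w.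
have Jprime x y : J (x * y) -> J x \/ J y.
  move=> Jxy; apply: contrapT => /not_orP[/enlarge[s Ss [u Ju [a es]]]].
  move=> /enlarge[s' Ss' [v Jv [b es']]].
  have : J (s * s').
    have -> : s * s' = (v + b * y) * u + (a * x * v + (a * b * (x * y) + 0)).
      by rewrite es es'; ring.
    by apply: (JD) => //; apply: (JD) => //; apply: JD.
  by move=> /JS; apply; apply: SM.
have [L [f fE]] := residue_field J0 JD J1 Jprime.
exists L, f; split=> x; first by move/IJ/fE.
by move=> Sx /fE/JS; apply.
Qed.

(** * Morphisms on the affine curve *)

Lemma rmorph_mmap (n : nat) (R S S' : comNzRingType) (h : {rmorphism R -> S})
    (k : 'I_n -> S) (f : {rmorphism S -> S'}) (p : {mpoly R[n]}) :
  f (mmap h k p) = mmap (f \o h) (f \o k) p.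
Proof.
rewrite /mmap rmorph_sum; apply: eq_bigr => m _.
rewrite rmorphM /= /mmap1 rmorph_prod; congr (_ * _).
by apply: eq_bigr => i _; rewrite rmorphXn.
Qed.

Lemma rmorph_mpolyE (n : nat) (R S : comNzRingType)
    (f : {rmorphism {mpoly R[n]} -> S}) (p : {mpoly R[n]}) :
  f p = mmap (f \o @mpolyC n R) (fun i => f (mpolyX R U_(i))) p.
Proof.
rewrite [in LHS](mpolyE p) rmorph_sum; apply: eq_bigr => m _.
rewrite -mul_mpolyC rmorphM /=; congr (_ * _).
rewrite /mmap1 [in LHS]mpolyXE_id rmorph_prod; apply: eq_bigr => i _.
by rewrite rmorphXn.
Qed.

(** Evaluation at (x : y : 1). The target is a ring because it is also applied in the coordinate
    ring. *)
Definition ev (K : fieldType) (S : comNzRingType) (iota : {rmorphism K -> S})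
    (x y : S) : {mpoly K[3]} -> S := mmap iota (tnth [tuple x; y; 1]).

HB.instance Definition _ (K : fieldType) (S : comNzRingType)
  (iota : {rmorphism K -> S}) x y := GRing.RMorphism.on (ev iota x y).

Definition affine_map (K : fieldType) (W W' : weierstrass K) (Phi : charts K)
    (p q : {mpoly K[3]}) : Prop :=
  forall (L : fieldType) (iota : {rmorphism K -> L}) (x y : L),
    affine_eq (base_change iota W) x y ->
    affine_eq (base_change iota W') (ev iota x y p) (ev iota x y q)
    /\ sends iota Phi (Affine x y) (Affine (ev iota x y p) (ev iota x y q)).

(* By the Nullstellensatz, the third coordinates of the charts generate the
   unit ideal of the coordinate ring of the affine curve. *)
Lemma morphism_affine_map (K : fieldType) (W W' : weierstrass K) (Phi : charts K) :
    is_morphism W W' Phi ->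
    (forall (L : fieldType) (iota : {rmorphism K -> L}) (x y : L),
       affine_eq (base_change iota W) x y ->
       ~ sends iota Phi (Affine x y) Infinity) ->
  exists p q, affine_map W W' Phi p q.
Proof.
move=> [_ Phi_mor] Phi_fin; pose i2 : 'I_3 := ord_max.
pose X (i : nat) : {mpoly K[3]} := mpolyX K U_(inord i).
pose w := X 1 ^+ 2 + (a1 W)%:MP * X 0 * X 1 + (a3 W)%:MP * X 1
  - (X 0 ^+ 3 + (a2 W)%:MP * X 0 ^+ 2 + (a4 W)%:MP * X 0 + (a6 W)%:MP).
(* The ideal is generated by the curve equation, by [X 2 - 1], which dehomogenizes, and by the third
   coordinates of the charts. *)
pose comb c0 c1 (c : 'I_(size Phi) -> {mpoly K[3]}) :=
  c0 * w + c1 * (X 2 - 1) + \sum_j c j * tnth (tnth (in_tuple Phi) j) i2.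
have [c0 [c1 [c one]]] : exists c0 c1 c, comb c0 c1 c = 1.
  apply: contrapT => no1.
  (* Otherwise some field carries an affine point of [W] at which all third coordinates vanish. Its
     image is not at infinity by [Phi_fin], but at an affine image a nonvanishing chart has nonzero
     third coordinate. *)
  have [] := @field_avoiding _
    [set r | exists c0 c1 c, comb c0 c1 c = r]%classic [set 1]%classic.
  - exists 0, 0, (fun=> 0); rewrite /comb !mul0r !add0r big1 // => F _.
    by rewrite mul0r.
  - move=> a _ _ [c0 [c1 [c <-]]] [d0 [d1 [d <-]]].
    exists (a * c0 + d0), (a * c1 + d1), (fun j => a * c j + d j).
    rewrite /comb (eq_bigr (fun j => a * (c j * tnth (tnth (in_tuple Phi) j) i2)
      + d j * tnth (tnth (in_tuple Phi) j) i2)).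
      by rewrite big_split /= -mulr_sumr; ring.
    by move=> F _; ring.
  - by [].
  - by move=> x y -> ->; rewrite mul1r.
  - by move=> x [c0 [c1 [c e]]] x1; apply: no1; exists c0, c1, c; rewrite e x1.
  move=> L [f [f0 _]].
  have fw : f w = 0.
    apply: f0; exists 1, 0, (fun=> 0); rewrite /comb big1 => [|F _]; rewrite ?mul0r //.
    by rewrite mul1r !addr0.
  have fz : f (X 2) = 1.
    apply/eqP; rewrite -subr_eq0 -(rmorph1 f) -rmorphB; apply/eqP; apply: f0.
    exists 0, 1, (fun=> 0); rewrite /comb big1 => [|F _]; rewrite ?mul0r //.
    by rewrite mul1r add0r addr0.
  pose iota := f \o @mpolyC 3 K.
  have fE (p : {mpoly K[3]}) : mmap iota (tnth [tuple f (X 0); f (X 1); 1]) p = f p.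
    rewrite [RHS]rmorph_mpolyE /mmap; apply: eq_bigr => m _; congr (_ * _).
    apply: mmap1_eq => i; rewrite (tnth_nth 0); move: fz; rewrite /X.
    case: i => -[|[|[|//]]] lti fz /=; rewrite -?fz; congr (f (mpolyX _ U_(_)));
    by apply: val_inj; rewrite /= inordK.
  have onL : affine_eq (base_change iota W) (f (X 0)) (f (X 1)).
    apply/eqP; rewrite -subr_eq0 -fw /w /=.
    by apply/eqP; ring.
  have [[|x' y'] _ sQ] := Phi_mor L iota (Affine (f (X 0)) (f (X 1))) onL.
    exact: Phi_fin onL sQ.
  have [vQ [F FPhi [i nz]]] := sQ; have [d ed] := vQ F FPhi.
  case/seq_tnthP: FPhi => j eF.
  have F2 : f (tnth F i2) = 0.
    apply: f0; exists 0, 0, (fun k => (k == j)%:R); rewrite /comb !mul0r !add0r.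
    rewrite (bigD1 j) //= eqxx mul1r big1 ?addr0 -?eF // => k /negPf ->.
    by rewrite mul0r.
  have d0 : d = 0 by rewrite -F2 -fE [RHS]ed /= mulr1.
  by move: nz; rewrite ed d0 mul0r eqxx.
(* The same combination of whole charts has third coordinate 1 on the affine curve, so its first two
   coordinates are the affine coordinates of the image. *)
pose p i := \sum_j c j * tnth (tnth (in_tuple Phi) j) i.
exists (p ord0), (p (lift ord0 ord0)) => L iota x y onP.
have [Q onQ sQ] := Phi_mor L iota (Affine x y) onP.
case: Q onQ sQ => [|x' y'] onQ sQ; first by case: (Phi_fin _ _ _ _ onP sQ).
have [vQ _] := sQ.
have evX i : ev iota x y (X i) = nth 0 [tuple x; y; 1] (inord i : 'I_3).
  by rewrite /ev mmapX mmap1U (tnth_nth 0).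
have evw : ev iota x y w = 0.
  have -> : ev iota x y w = ev iota x y (X 1) ^+ 2
      + ev iota x y (a1 W)%:MP * ev iota x y (X 0) * ev iota x y (X 1)
      + ev iota x y (a3 W)%:MP * ev iota x y (X 1)
      - (ev iota x y (X 0) ^+ 3 + ev iota x y (a2 W)%:MP * ev iota x y (X 0) ^+ 2
         + ev iota x y (a4 W)%:MP * ev iota x y (X 0) + ev iota x y (a6 W)%:MP).
    by rewrite /w; ring.
  rewrite !evX !inordK //= /ev !mmapC.
  by apply/eqP; rewrite subr_eq0; apply/eqP.
pose Q : 'I_3 -> L := tnth (coords (Affine x' y')).
have valF j : exists e, forall i,
    ev iota x y (tnth (tnth (in_tuple Phi) j) i) = e * Q i.
  exact: vQ (mem_tnth j (in_tuple Phi)).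
have [e eE] := choice valF.
have ep i : ev iota x y (p i) = (\sum_j ev iota x y (c j) * e j) * Q i.
  rewrite rmorph_sum mulr_suml; apply: eq_bigr => j _.
  by rewrite rmorphM -mulrA /= eE.
have Q2 : ev iota x y (p i2) = 1.
  have := congr1 (ev iota x y) one; rewrite rmorph1 /comb rmorphD rmorphD !rmorphM /=.
  have -> : ev iota x y (X 2 - 1) = 0.
    by rewrite [LHS]rmorphB [X in _ - X]rmorph1 /= evX inordK //= subrr.
  by rewrite evw !mulr0 !add0r.
have s1 : \sum_j ev iota x y (c j) * e j = 1 by rewrite -Q2 ep mulr1.
by rewrite !ep s1 !mul1r.
Qed.

(** * Pole orders in the coordinate ring *)

(* The pair (a, b) stands for a + b y. *)
Definition coord_ring (K : fieldType) (W : weierstrass K) : Type :=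
  ({poly K} * {poly K})%type.

Section CoordinateRing.
Variables (K : fieldType) (W : weierstrass K).

Local Notation A := (coord_ring W).
HB.instance Definition _ := GRing.Zmodule.on A.

Implicit Types p q : A.

(** The curve reads y^2 + h y = c; this relation reduces products in [cr_mul]. *)
Definition cr_h : {poly K} := (a1 W)%:P * 'X + (a3 W)%:P.
Definition cr_c : {poly K} :=
  'X^3 + (a2 W)%:P * 'X^2 + (a4 W)%:P * 'X + (a6 W)%:P.

Definition cr_one : A := (1, 0).
Definition cr_mul (p q : A) : A :=
  (p.1 * q.1 + p.2 * q.2 * cr_c, p.1 * q.2 + p.2 * q.1 - p.2 * q.2 * cr_h).

Fact cr_mulA : associative cr_mul.
Proof. by move=> p q r; rewrite /cr_mul; congr (_, _) => /=; ring. Qed.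
Fact cr_mulC : commutative cr_mul.
Proof. by move=> p q; rewrite /cr_mul; congr (_, _) => /=; ring. Qed.
Fact cr_mul1 : left_id cr_one cr_mul.
Proof. by case=> a b; rewrite /cr_mul; congr (_, _) => /=; ring. Qed.
Fact cr_mulDl : left_distributive cr_mul +%R.
Proof. by move=> p q r; rewrite /cr_mul; congr (_, _) => /=; ring. Qed.
Fact cr_one_neq0 : cr_one != 0.
Proof. by rewrite -pair_eqE /= negb_and oner_neq0. Qed.
HB.instance Definition _ := GRing.Zmodule_isComNzRing.Build A
  cr_mulA cr_mulC cr_mul1 cr_mulDl cr_one_neq0.

Definition cr_const (a : K) : A := (a%:P, 0).
Fact cr_const_zmod : zmod_morphism cr_const.
Proof. by move=> a b; congr (_, _); rewrite ?rmorphB ?subr0. Qed.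
Fact cr_const_monoid : monoid_morphism cr_const.
Proof. by split=> [//|a b]; congr (_, _) => /=; ring. Qed.
HB.instance Definition _ := GRing.isZmodMorphism.Build K A cr_const
  cr_const_zmod.
HB.instance Definition _ := GRing.isMonoidMorphism.Build K A cr_const
  cr_const_monoid.

Definition cr_x : A := ('X, 0).
Definition cr_y : A := (0, 1).

Lemma cr_eq : cr_y ^+ 2 + cr_const (a1 W) * cr_x * cr_y + cr_const (a3 W) * cr_y
  = cr_x ^+ 3 + cr_const (a2 W) * cr_x ^+ 2 + cr_const (a4 W) * cr_x + cr_const (a6 W).
Proof. by congr (_, _) => /=; rewrite /cr_c /cr_h; ring. Qed.

(** The norm to [K[x]]: the product of a + b y and its conjugate a + b (-y - h). *)
Definition cr_norm (p : A) : {poly K} :=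
  p.1 ^+ 2 - cr_h * p.1 * p.2 - cr_c * p.2 ^+ 2.

Lemma cr_normM p q : cr_norm (p * q) = cr_norm p * cr_norm q.
Proof. by rewrite /cr_norm /=; ring. Qed.

(* Two more than the pole order at infinity, and 0 at 0. *)
Definition cr_size (p : A) : nat :=
  maxn (2 * size p.1)%N (if p.2 == 0 then 0%N else (2 * size p.2 + 3)%N).
Arguments cr_size p%_R.

Lemma size_cr_c : size cr_c = 4.
Proof.
rewrite /cr_c -!addrA size_polyDl ?size_polyXn //.
rewrite ltnS (leq_trans (size_polyD _ _)) // geq_max.
rewrite mul_polyC (leq_trans (size_scale_leq _ _)) ?size_polyXn //=.
rewrite (leq_trans (size_polyD _ _)) // geq_max.
rewrite mul_polyC (leq_trans (size_scale_leq _ _)) ?size_polyX //=.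
by rewrite (leq_trans (size_polyC_leq1 _)).
Qed.

Lemma size_cr_h : (size cr_h <= 2)%N.
Proof.
rewrite /cr_h (leq_trans (size_polyD _ _)) // geq_max.
rewrite mul_polyC (leq_trans (size_scale_leq _ _)) ?size_polyX //=.
by rewrite (leq_trans (size_polyC_leq1 _)).
Qed.

(** In a^2 - h a b - c b^2 the outer terms have even and odd degree, so they cannot cancel, and h a
    b has smaller degree than the larger of them. Multiplicativity of the norm then makes pole
    orders additive. *)
Lemma size_cr_norm p : size (cr_norm p) = (cr_size p).-1.
Proof.
case: p => a b; rewrite /cr_norm /cr_size /=.
have szsq (q : {poly K}) : size (q ^+ 2) = ((size q).*2).-1.
  have [->|q0] := eqVneq q 0; first by rewrite expr0n /= size_poly0.
  by rewrite expr2 size_mul // addnn.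
have c0 : cr_c != 0 by rewrite -size_poly_eq0 size_cr_c.
have [->|b0] := eqVneq b 0.
  by rewrite expr0n /= !mulr0 !subr0 szsq; move: (size a) => n; lia.
have szc : size (cr_c * b ^+ 2) = (2 * size b + 2)%N.
  rewrite size_mul ?expf_neq0 // szsq size_cr_c; move: b0.
  by rewrite -size_poly_gt0; move: (size b) => m; lia.
have szh : (size (cr_h * a * b)%R <= size a + size b)%N.
  rewrite (leq_trans (size_polyMleq _ _)) //.
  have := size_polyMleq cr_h a; have := size_cr_h; move: b0.
  rewrite -size_poly_gt0; move: (size (_ * a)) (size cr_h) (size a) (size b).
  by move=> *; lia.
move: b0; rewrite -size_poly_gt0 => b0.
have [lt|le] := ltnP (size b).+1 (size a).
  have lt' : (size (- (cr_h * a * b) - cr_c * b ^+ 2)%R < size (a ^+ 2))%N.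
    rewrite -opprD size_polyN (leq_ltn_trans (size_polyD _ _)) // gtn_max szc szsq.
    by move: szh lt b0; move: (size (_ * b)) (size a) (size b) => *; lia.
  rewrite -addrA size_polyDl // szsq.
  by move: lt b0; move: (size a) (size b) => *; lia.
have lt' : (size (a ^+ 2 - cr_h * a * b)%R < size (- (cr_c * b ^+ 2)))%N.
  rewrite (leq_ltn_trans (size_polyD _ _)) // gtn_max !size_polyN szc szsq.
  by move: szh le b0; move: (size (_ * b)) (size a) (size b) => *; lia.
rewrite addrC size_polyDl // size_polyN szc.
by move: le b0; move: (size a) (size b) => *; lia.
Qed.

Lemma cr_size_eq0 p : (cr_size p == 0%N) = (p == 0).
Proof.
case: p => a b; rewrite /cr_size -pair_eqE /=.
case: (b == 0); rewrite ?andbT ?andbF -?size_poly_eq0.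
  by move: (size a) => n; apply/eqP/eqP; lia.
by move: (size a) (size b) => n m; apply/eqP; lia.
Qed.

Lemma cr_size_gt1 p : p != 0 -> (1 < cr_size p)%N.
Proof.
rewrite -cr_size_eq0 /cr_size; case: (p.2 == 0).
  by move: (size p.1) => n; lia.
by move: (size p.1) (size p.2) => n m; lia.
Qed.

Lemma cr_norm_eq0 p : (cr_norm p == 0) = (p == 0).
Proof.
rewrite -size_poly_eq0 size_cr_norm.
have [->|p0] := eqVneq p 0; first by rewrite /cr_size /= eqxx size_poly0.
by have := cr_size_gt1 p0; move: (cr_size p) => n; lia.
Qed.

Lemma cr_mulf_neq0 p q : p != 0 -> q != 0 -> p * q != 0.
Proof. by rewrite -!cr_norm_eq0 cr_normM mulf_eq0 negb_or => -> ->. Qed.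

Lemma cr_sizeM p q : p != 0 -> q != 0 ->
  (cr_size (p * q) + 2 = cr_size p + cr_size q)%N.
Proof.
move=> p0 q0; have pq0 := cr_mulf_neq0 p0 q0.
have := congr1 (fun r : {poly K} => size r) (cr_normM p q).
rewrite size_mul ?cr_norm_eq0 // !size_cr_norm.
by have := cr_size_gt1 p0; have := cr_size_gt1 q0; have := cr_size_gt1 pq0; lia.
Qed.

Lemma cr_sizeN p : cr_size (- p) = cr_size p.
Proof. by rewrite /cr_size /= !size_polyN oppr_eq0. Qed.

Lemma cr_sizeD p q : (cr_size (p + q) <= maxn (cr_size p) (cr_size q))%N.
Proof.
rewrite /cr_size /=; have := size_polyD p.1 q.1; have := size_polyD p.2 q.2.
rewrite -!size_poly_eq0; move: (size (p.2 + q.2)) (size (p.1 + q.1)).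
move: (size p.1) (size p.2) (size q.1) (size q.2) => n m n' m' k l.
by case: (m =P 0%N); case: (m' =P 0%N); case: (k =P 0%N); lia.
Qed.

(** The subtraction is truncated: the zero element gets pole order 0. *)
Definition pole p : nat := (cr_size p - 2)%N.
Arguments pole p%_R.

Lemma pole0 : pole 0 = 0%N.
Proof. by rewrite /pole /cr_size /= size_poly0 eqxx. Qed.

Lemma poleN p : pole (- p) = pole p. Proof. by rewrite /pole cr_sizeN. Qed.

Lemma poleD p q : (pole (p + q) <= maxn (pole p) (pole q))%N.
Proof. by rewrite /pole; have := cr_sizeD p q; lia. Qed.

Lemma poleD_le n p q : (pole p <= n)%N -> (pole q <= n)%N -> (pole (p + q) <= n)%N.
Proof. by move=> pn qn; apply: leq_trans (poleD p q) _; rewrite geq_max pn. Qed.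

Lemma poleDl p q : (pole q < pole p)%N -> pole (p + q) = pole p.
Proof.
move=> lt; have := poleD p q; have := poleD (p + q) (- q).
by rewrite addrK poleN; lia.
Qed.

Lemma poleM p q : p != 0 -> q != 0 -> pole (p * q) = (pole p + pole q)%N.
Proof.
move=> p0 q0; rewrite /pole; have := cr_sizeM p0 q0.
by have := cr_size_gt1 p0; have := cr_size_gt1 q0; lia.
Qed.

Lemma poleM_le p q : (pole (p * q) <= pole p + pole q)%N.
Proof.
have [->|p0] := eqVneq p 0; first by rewrite mul0r pole0.
have [->|q0] := eqVneq q 0; first by rewrite mulr0 pole0.
by rewrite poleM.
Qed.

Lemma poleX p n : pole (p ^+ n) = (n * pole p)%N.
Proof.
have [->|p0] := eqVneq p 0.
  case: n => [|n]; rewrite ?expr0n /= ?pole0 ?muln0 //.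
  by rewrite /pole /cr_size /= size_poly1 eqxx.
have pn0 k : p ^+ k != 0.
  by elim: k => [|k IH]; rewrite ?expr0 ?oner_neq0 // exprS cr_mulf_neq0.
elim: n => [|n IH]; first by rewrite /pole /cr_size /= size_poly1 eqxx.
by rewrite exprS poleM // IH mulSn.
Qed.

Lemma pole_const a : pole (cr_const a) = 0%N.
Proof.
rewrite /pole /cr_size /= eqxx maxn0; have := size_polyC_leq1 a.
by move: (size _) => n; lia.
Qed.

Lemma pole_x : pole cr_x = 2%N.
Proof. by rewrite /pole /cr_size /= eqxx size_polyX. Qed.

Lemma pole_y : pole cr_y = 3%N.
Proof. by rewrite /pole /cr_size /= oner_eq0 size_poly0 size_poly1. Qed.

End CoordinateRing.
Arguments pole {K W} p%_R.

Definition affine_eq_in (K : fieldType) (S : comNzRingType) (h : K -> S)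
    (W : weierstrass K) (x y : S) : Prop :=
  y ^+ 2 + h (a1 W) * x * y + h (a3 W) * y
  = x ^+ 3 + h (a2 W) * x ^+ 2 + h (a4 W) * x + h (a6 W).

Definition lin_y (K : fieldType) (S : comNzRingType) (h : {rmorphism K -> S})
    (x y : S) (g0 g1 : {poly K}) : S :=
  (map_poly h g0).[x] + (map_poly h g1).[x] * y.

(** The elements g0(x) + g1(x) y form a subring: the curve equation removes y^2 from products, by
    the same formula as [cr_mul]. *)
Lemma ev_lin_y (K : fieldType) (S : comNzRingType) (h : {rmorphism K -> S})
    (W : weierstrass K) (x y : S) (p : {mpoly K[3]}) : affine_eq_in h W x y ->
  exists g0 g1, ev h x y p = lin_y h x y g0 g1.
Proof.
move=> E; pose span s := exists g0 g1, s = lin_y h x y g0 g1.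
have spanC a : span (h a).
  by exists a%:P, 0; rewrite /lin_y map_polyC rmorph0 hornerC horner0 mul0r addr0.
have spanx : span x.
  by exists 'X, 0; rewrite /lin_y map_polyX rmorph0 hornerX horner0 mul0r addr0.
have spany : span y.
  by exists 0, 1; rewrite /lin_y rmorph0 rmorph1 horner0 hornerC mul1r add0r.
have spanD s s' : span s -> span s' -> span (s + s').
  move=> [g0 [g1 ->]] [k0 [k1 ->]]; exists (g0 + k0), (g1 + k1).
  by rewrite /lin_y !rmorphD !hornerD; ring.
have spanM s s' : span s -> span s' -> span (s * s').
  move=> [g0 [g1 ->]] [k0 [k1 ->]].
  exists (g0 * k0 + g1 * k1 * cr_c W), (g0 * k1 + g1 * k0 - g1 * k1 * cr_h W).
  have hc : (map_poly h (cr_c W)).[x]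
      = x ^+ 3 + h (a2 W) * x ^+ 2 + h (a4 W) * x + h (a6 W).
    rewrite /cr_c !rmorphD /= map_polyXn !rmorphM /= !map_polyC map_polyX.
    by rewrite !hornerE; ring.
  have hh : (map_poly h (cr_h W)).[x] = h (a1 W) * x + h (a3 W).
    by rewrite /cr_h rmorphD rmorphM /= !map_polyC map_polyX !hornerE.
  move: (cr_c W) (cr_h W) hc hh => c e hc hh.
  rewrite /lin_y !(rmorphD, rmorphN, rmorphM) !hornerE /= hc hh.
  apply: (lincomb1 (k := (map_poly h g1).[x] * (map_poly h k1).[x]) E); ring.
have span1 : span 1 by rewrite -(rmorph1 h); apply: spanC.
have span0 : span 0 by rewrite -(rmorph0 h); apply: spanC.
rewrite /ev /mmap; apply: (big_ind span); [by []|exact: spanD|move=> m _].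
apply: (spanM) => //; rewrite /mmap1.
apply: (big_ind span); [by []|exact: spanM|move=> i _].
elim: (m i) => [|k IH]; first by rewrite expr0.
rewrite exprS; apply: spanM => //.
by rewrite (tnth_nth 0); case: i {IH} => -[|[|[|//]]].
Qed.

(** * Pole orders of a pair of functions satisfying a Weierstrass equation *)

Section PoleOrders.
Variables (K : fieldType) (W W' : weierstrass K).
Implicit Types (x y : coord_ring W) (g : {poly K}).
Local Notation h := (@cr_const K W).

(** The leading term dominates, because [x] has a pole; the induction follows Horner's scheme. *)
Lemma pole_horner g x : (0 < pole x)%N -> g != 0 ->
  (map_poly h g).[x] != 0 /\ pole (map_poly h g).[x] = ((size g).-1 * pole x)%N.
Proof.
move=> px; have pnz (p : coord_ring W) : (0 < pole p)%N -> p != 0.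
  by move=> pp; apply/eqP => p0; rewrite p0 pole0 in pp.
elim/poly_ind: g => [|g c IH]; first by rewrite eqxx.
rewrite rmorphD rmorphM /= map_polyC map_polyX hornerMXaddC size_MXaddC /=.
have [->|g0] := eqVneq g 0.
  rewrite !rmorph0 horner0 mul0r !add0r /= polyC_eq0 mul0r add0r => c0.
  rewrite (negPf c0) size_poly0 mul0n pole_const; split=> //.
  by rewrite -pair_eqE /= polyC_eq0 eqxx andbT.
have [hg0 pg] := IH g0; move=> _.
have hx0 : (map_poly h g).[x] * x != 0 by apply: cr_mulf_neq0 => //; apply: pnz.
have pgx : pole ((map_poly h g).[x] * x) = ((size g).-1 * pole x + pole x)%N.
  by rewrite poleM ?pg //; apply: pnz.
have -> : (if false && (c == 0) then 0%N else (size g).+1).-1 = size g.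
  by [].
have pgx' : pole ((map_poly h g).[x] * x + h c) = (size g * pole x)%N.
  rewrite poleDl pgx ?pole_const ?addn_gt0 ?px ?orbT //.
  by rewrite -{2}(prednK (_ : 0 < size g)%N) ?size_poly_gt0 // mulSn addnC.
by split=> //; apply: pnz; rewrite pgx' muln_gt0 px size_poly_gt0 g0.
Qed.

Lemma pole_horner0 g x : pole x = 0%N -> pole (map_poly h g).[x] = 0%N.
Proof.
move=> px; elim/poly_ind: g => [|g c IH]; first by rewrite rmorph0 horner0 pole0.
rewrite rmorphD rmorphM /= map_polyC map_polyX hornerMXaddC /=.
apply/eqP; rewrite -leqn0; apply: poleD_le; last by rewrite pole_const.
by rewrite (leq_trans (poleM_le _ _)) // IH px.
Qed.

(** The poles of y^2 and x^3 must balance, since the other terms have order at most 2 [pole x] or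
    [pole x] + [pole y]. *)
Lemma pole_affine_eq x y : affine_eq_in h W' x y ->
  (2 * pole y = 3 * pole x)%N.
Proof.
move=> E; have pcM a p : (pole (h a * p) <= pole p)%N.
  by have := poleM_le (h a) p; rewrite pole_const.
pose l := h (a1 W') * (x * y) + h (a3 W') * y.
pose r := h (a2 W') * x ^+ 2 + h (a4 W') * x + h (a6 W').
have pl : (pole l <= pole x + pole y)%N.
  by apply: poleD_le; apply: (leq_trans (pcM _ _)); rewrite ?poleM_le ?leq_addl.
have pr : (pole r <= 2 * pole x)%N.
  apply: poleD_le; [apply: poleD_le|by rewrite pole_const].
    by rewrite (leq_trans (pcM _ _)) // poleX.
  by rewrite (leq_trans (pcM _ _)) // leq_pmull.
have ey : y ^+ 2 = x ^+ 3 + (r - l).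
  by apply: (lincomb1 (k := 1) E); rewrite /r /l; ring.
have ex : x ^+ 3 = y ^+ 2 + (l - r) by rewrite ey; ring.
have : (2 * pole y <= maxn (3 * pole x) (pole x + pole y))%N.
  rewrite -poleX ey; apply: poleD_le; first by rewrite poleX leq_maxl.
  apply: poleD_le; rewrite ?poleN; [apply: leq_trans pr _|apply: leq_trans pl _].
    by lia.
  by lia.
have : (3 * pole x <= maxn (2 * pole y) (maxn (2 * pole x) (pole x + pole y)))%N.
  rewrite -poleX ex; apply: poleD_le; first by rewrite poleX leq_maxl.
  apply: poleD_le; rewrite ?poleN; [apply: leq_trans pl _|apply: leq_trans pr _].
    by lia.
  by lia.
by lia.
Qed.

(* Every element of K[x, y] has a pole order divisible by d, where 2d and 3d
   are the pole orders of x and y; since 2 and 3 are attained, d = 1. *)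
Lemma pole_generators x y g0 g1 k0 k1 : affine_eq_in h W' x y ->
    lin_y h x y g0 g1 = cr_x W -> lin_y h x y k0 k1 = cr_y W ->
  pole x = 2%N /\ pole y = 3%N.
Proof.
move=> /pole_affine_eq Exy Ex Ey.
have px : (0 < pole x)%N.
  (* Without poles of [x] and [y], nothing in K[x, y] would have a pole, but [cr_x W] has one. *)
  rewrite lt0n; apply/eqP => px; have py : pole y = 0%N by lia.
  suff : (pole (cr_x W) <= 0)%N by rewrite pole_x.
  rewrite -Ex; apply: poleD_le; first by rewrite pole_horner0.
  by rewrite (leq_trans (poleM_le _ _)) // pole_horner0 // py.
have y0 : y != 0 by apply/eqP => y0; move: Exy; rewrite y0 pole0; lia.
have [d [dx dy]] : exists d, pole x = (2 * d)%N /\ pole y = (3 * d)%N.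
  by exists (pole y - pole x)%N; lia.
have dvd k l : (d %| pole (lin_y h x y k l))%N.
  rewrite /lin_y; have [->|k_nz] := eqVneq k 0.
    rewrite rmorph0 horner0 add0r; have [->|l_nz] := eqVneq l 0.
      by rewrite rmorph0 horner0 mul0r pole0 dvdn0.
    have [l0 pl] := pole_horner px l_nz; rewrite poleM // pl dx dy.
    by rewrite mulnA dvdn_add // dvdn_mull.
  have [_ pk] := pole_horner px k_nz; have [->|l_nz] := eqVneq l 0.
    by rewrite rmorph0 horner0 mul0r addr0 pk dx mulnA dvdn_mull.
  have [l0 pl] := pole_horner px l_nz.
  have ply : pole ((map_poly h l).[x] * y) = ((size l).-1 * (2 * d) + 3 * d)%N.
    by rewrite poleM // pl dx dy.
  rewrite dx in pk.
  have dk : (d %| pole (map_poly h k).[x])%N by rewrite pk mulnA dvdn_mull.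
  have dl : (d %| pole ((map_poly h l).[x] * y))%N.
    by rewrite ply mulnA dvdn_add ?dvdn_mull.
  have [lt|gt|eq] := ltngtP (pole (map_poly h k).[x]) (pole ((map_poly h l).[x] * y)).
  - by rewrite addrC poleDl.
  - by rewrite poleDl.
  (* The order of g(x) is an even multiple of [d] and that of g(x) y an odd one, so the two never
     cancel. *)
  - exfalso; move: eq; rewrite pk ply; move: px; rewrite dx.
    move: (size k) (size l) => m n d0 e.
    have /eqP : (d * (2 * m.-1) = d * (2 * n.-1 + 3))%N by lia.
    by rewrite eqn_pmul2l; lia.
have d2 := dvd g0 g1; have d3 := dvd k0 k1; rewrite Ex pole_x in d2.
rewrite Ey pole_y in d3; have : (d %| 3 - 2)%N by rewrite dvdn_sub.
by rewrite dvdn1 => /eqP d1; rewrite dx dy d1.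
Qed.

End PoleOrders.

(** * Isomorphisms are changes of variables *)

Lemma ev_rmorph (K : fieldType) (S S' : comNzRingType) (h : {rmorphism K -> S})
    (f : {rmorphism S -> S'}) x y p : f (ev h x y p) = ev (f \o h) (f x) (f y) p.
Proof.
rewrite /ev rmorph_mmap /mmap; apply: eq_bigr => m _; congr (_ * _).
apply: mmap1_eq => i; rewrite /= !(tnth_nth 0).
by case: i => -[|[|[|//]]] lti //=; rewrite rmorph1.
Qed.

Lemma sends_infinity (K L : fieldType) (iota : {rmorphism K -> L}) (Phi : charts K) :
  sends idfun Phi (@Infinity K) Infinity -> sends iota Phi Infinity Infinity.
Proof.
have vE F i : mmap iota (tnth (coords (@Infinity L))) (tnth F i)
    = iota (mmap idfun (tnth (coords (@Infinity K))) (tnth F i)).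
  rewrite rmorph_mmap /mmap; apply: eq_bigr => m _; congr (_ * _).
  apply: mmap1_eq => j; rewrite /= !(tnth_nth 0).
  by case: j => -[|[|[|//]]] lti //=; rewrite ?rmorph1 ?rmorph0.
move=> [v [F FPhi [i nz]]]; split.
  move=> G GPhi; have [c e] := v G GPhi; exists (iota c) => j.
  rewrite vE e rmorphM; congr (_ * _); rewrite !(tnth_nth 0).
  by case: j => -[|[|[|//]]] lti //=; rewrite ?rmorph1 ?rmorph0.
by exists F => //; exists i; rewrite vE fmorph_eq0.
Qed.

(* The generic point of W is a point over a field extension into which the
   coordinate ring of W embeds. *)
Lemma generic_isomorphism (K : fieldType) (W W' : weierstrass K) :
    isomorphic W W' ->
  exists (x y : coord_ring W) g0 g1 k0 k1,
    [/\ affine_eq_in (@cr_const K W) W' x y,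
        lin_y (@cr_const K W) x y g0 g1 = cr_x W
      & lin_y (@cr_const K W) x y k0 k1 = cr_y W].
Proof.
move=> [Phi [Psi [morPhi morPsi infPhi inv]]].
have infPhiL (L : fieldType) (iota : {rmorphism K -> L}) := sends_infinity iota infPhi.
have infPsiL (L : fieldType) (iota : {rmorphism K -> L}) :
    sends iota Psi Infinity Infinity.
  by apply/(inv L iota Infinity Infinity).
(* No affine point goes to infinity: the inverse would send infinity back to that point, but it
   fixes infinity. *)
have [L iota x y onP sP|p [q pq]] := morphism_affine_map morPhi.
  have := (inv L iota (Affine x y) Infinity onP I).1 sP.
  by move/sends_uniq/(_ (infPsiL L iota)).
have [L iota x y onP sP|p' [q' pq']] := morphism_affine_map morPsi.
  have := (inv L iota Infinity (Affine x y) I onP).2 sP.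
  by move/sends_uniq/(_ (infPhiL L iota)).
have [|||||L [f [_ f_neq0]]] := @field_avoiding (coord_ring W) [set 0]%classic
  [set z | z != 0]%classic.
- by [].
- by move=> a x y -> ->; rewrite mulr0 addr0.
- exact: oner_neq0.
- exact: cr_mulf_neq0.
- by move=> x ->; rewrite /= eqxx.
have f_inj z z' : f z = f z' -> z = z'.
  move=> e; apply/eqP; rewrite -subr_eq0; apply: contrapT => /negP /f_neq0.
  by rewrite rmorphB e subrr.
pose iota := f \o @cr_const K W; pose c := @cr_const K W.
have onP : affine_eq (base_change iota W) (f (cr_x W)) (f (cr_y W)).
  have := congr1 f (cr_eq W); rewrite /affine_eq /= => e.
  by apply: (lincomb1 (k := 1) e); ring.
pose x := ev c (cr_x W) (cr_y W) p; pose y := ev c (cr_x W) (cr_y W) q.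
have [onQ sQ] := pq L iota _ _ onP; rewrite -!ev_rmorph -/x -/y in onQ sQ.
have [_ sP] := pq' L iota _ _ onQ; rewrite -!ev_rmorph in sP.
have sP' := (inv L iota (Affine _ _) (Affine _ _) onP onQ).1 sQ.
(* The inverse map returns the generic point; as [f] is injective, [cr_x W] and [cr_y W] are
   polynomials in [x] and [y] already in the coordinate ring. *)
have [/f_inj ex /f_inj ey] := sends_uniq sP sP'.
have E : affine_eq_in (@cr_const K W) W' x y.
  apply: f_inj; move: onQ; rewrite /affine_eq /= => e.
  by apply: (lincomb1 (k := 1) e); ring.
have [g0 [g1 eg]] := ev_lin_y p' E; have [k0 [k1 ek]] := ev_lin_y q' E.
by exists x, y, g0, g1, k0, k1; split; rewrite // -?eg -?ek.
Qed.

Lemma cubic_eq0 (K : fieldType) (e0 e1 e2 e3 : K) :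
  e0%:P + e1%:P * 'X + e2%:P * 'X^2 + e3%:P * 'X^3 = 0 ->
  [/\ e0 = 0, e1 = 0, e2 = 0 & e3 = 0].
Proof.
move=> E; have coef i := congr1 (fun g : {poly K} => g`_i) E.
have := (coef 0, coef 1, coef 2, coef 3)%N.
rewrite !(coefD, coefCM, coefC, coefX, coefXn) /= !mulr0 !mulr1.
by rewrite !(addr0, add0r) => -[[[]]].
Qed.

Lemma size2_poly (K : fieldType) (g : {poly K}) : (size g <= 2)%N ->
  g = g`_1 *: 'X + (g`_0)%:P.
Proof.
move=> sg; apply/polyP => i; rewrite coefD coefZ coefX coefC.
case: i => [|[|i]]; rewrite /= ?mulr0 ?mulr1 ?add0r ?addr0 //.
by rewrite nth_default // (leq_trans sg).
Qed.

(** A nonzero coefficient of y would force a pole of order at least 3. *)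
Lemma pole2P (K : fieldType) (W : weierstrass K) (x : coord_ring W) :
  pole x = 2%N -> exists al be : K, al != 0 /\ x = (al%:P * 'X + be%:P, 0).
Proof.
case: x => a b; rewrite /pole /cr_size /=; case: eqP => [->|/eqP b0]; last first.
  move: b0; rewrite -size_poly_gt0; move: (size b) (size a) => m n; lia.
move=> sa; have sa2 : size a = 2%N by move: sa; move: (size a) => n; lia.
exists a`_1, a`_0; split; last by rewrite mul_polyC -size2_poly ?sa2.
by have := lead_coef_eq0 a; rewrite /lead_coef sa2 /= => ->; rewrite -size_poly_eq0 sa2.
Qed.

Lemma pole3P (K : fieldType) (W : weierstrass K) (y : coord_ring W) :
  pole y = 3%N ->
  exists ga de ep : K, ga != 0 /\ y = (de%:P * 'X + ep%:P, ga%:P).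
Proof.
case: y => a b; rewrite /pole /cr_size /=; case: eqP => [->|/eqP b0].
  by move: (size a) => n; lia.
move=> s; have [sb sa] : size b = 1%N /\ (size a <= 2)%N.
  by move: b0 s; rewrite -size_poly_gt0; move: (size a) (size b) => m n; lia.
have /size_poly1P[ga ga0 ->] : size b == 1%N by rewrite sb.
by exists ga, a`_1, a`_0; rewrite mul_polyC -size2_poly.
Qed.

(** The generators are al x + be and ga y + de x + ep. Comparing coefficients in the equation of
    [W'] gives ga^2 = al^3, hence al = u^-2 and ga = u^-3 for u = al/ga, and determines the
    coefficients of [W]. *)
Lemma isomorphic_transformed (K : fieldType) (W W' : weierstrass K) :
  isomorphic W W' -> exists u r s t : K, u != 0 /\ W = transform u r s t W'.
Proof.
move=> /generic_isomorphism[x [y [g0 [g1 [k0 [k1 [E Ex Ey]]]]]]].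
have [px py] := pole_generators E Ex Ey.
have [al [be [al0 ex]]] := pole2P px.
have [ga [de [ep [ga0 ey]]]] := pole3P py.
rewrite {}ex {}ey /affine_eq_in /cr_const in E px py *.
have := congr1 (fun z : coord_ring W => z.2) E.
have := congr1 (fun z : coord_ring W => z.1) E.
rewrite /= /cr_c /cr_h => E1 E2 {E Ex Ey px py}.
have [e20 e21 _ _] : [/\ ga * (2%:R * ep - ga * a3 W + a1 W' * be + a3 W') = 0,
    ga * (2%:R * de - ga * a1 W + a1 W' * al) = 0, (0 : K) = 0 & (0 : K) = 0].
  by apply: cubic_eq0; apply: (lincomb1 (k := 1) E2); ring.
have [e10 e11 e12 e13] : [/\
    ep ^+ 2 + ga ^+ 2 * a6 W + a1 W' * be * ep + a3 W' * ep
      - (be ^+ 3 + a2 W' * be ^+ 2 + a4 W' * be + a6 W') = 0,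
    2%:R * de * ep + ga ^+ 2 * a4 W + a1 W' * (al * ep + be * de) + a3 W' * de
      - (3%:R * al * be ^+ 2 + 2%:R * a2 W' * al * be + a4 W' * al) = 0,
    de ^+ 2 + ga ^+ 2 * a2 W + a1 W' * al * de
      - (3%:R * al ^+ 2 * be + a2 W' * al ^+ 2) = 0
    & ga ^+ 2 - al ^+ 3 = 0].
  by apply: cubic_eq0; apply: (lincomb1 (k := 1) E1); ring.
have {}e20 := mulfI ga0 (etrans e20 (esym (mulr0 ga))).
have {}e21 := mulfI ga0 (etrans e21 (esym (mulr0 ga))).
pose u := al / ga; have u0 : u != 0 by rewrite mulf_neq0 ?invr_eq0.
have e3' : ga ^+ 2 = al ^+ 3 by apply/eqP; rewrite -subr_eq0 e13.
have eal : al = u ^- 2.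
  have -> : u ^- 2 = ga ^+ 2 / al ^+ 2 by rewrite /u; field; rewrite al0 ga0.
  by rewrite e3'; field.
have ega : ga = u ^- 3.
  have -> : u ^- 3 = ga ^+ 2 * ga / al ^+ 3 by rewrite /u; field; rewrite al0 ga0.
  by rewrite -e3'; field.
(* These values come from solving the affine substitution for the coordinates of [W]. *)
exists u, (- be / al), (- de / ga), (de * be / (al * ga) - ep / ga); split=> //.
have e2 : a1 W = (2%:R * de + a1 W' * al) / ga.
  by apply: (mulIf ga0); rewrite divfK //; apply: (lincomb1 (k := -1) e21); ring.
have e3 : a3 W = (2%:R * ep + a1 W' * be + a3 W') / ga.
  by apply: (mulIf ga0); rewrite divfK //; apply: (lincomb1 (k := -1) e20); ring.
have ga2 : ga ^+ 2 != 0 by rewrite expf_neq0.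
have e4 : a2 W = (3%:R * al ^+ 2 * be + a2 W' * al ^+ 2
    - de ^+ 2 - a1 W' * al * de) / ga ^+ 2.
  by apply: (mulIf ga2); rewrite divfK //; apply: (lincomb1 (k := 1) e12); ring.
have e5 : a4 W = (3%:R * al * be ^+ 2 + 2%:R * a2 W' * al * be + a4 W' * al
    - 2%:R * de * ep - a1 W' * (al * ep + be * de) - a3 W' * de) / ga ^+ 2.
  by apply: (mulIf ga2); rewrite divfK //; apply: (lincomb1 (k := 1) e11); ring.
have e6 : a6 W = (be ^+ 3 + a2 W' * be ^+ 2 + a4 W' * be + a6 W'
    - ep ^+ 2 - a1 W' * be * ep - a3 W' * ep) / ga ^+ 2.
  by apply: (mulIf ga2); rewrite divfK //; apply: (lincomb1 (k := 1) e10); ring.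
case: W e2 e3 e4 e5 e6 {x y E1 E2 e20 e21 e10 e11 e12 e13 e3'}.
move=> A1 A2 A3 A4 A6 /= -> -> -> -> ->.
rewrite eal ega /transform /=; congr Weierstrass; field; by rewrite u0 oner_neq0.
Qed.

(** * Points of order 8 in characteristic 2 *)

Lemma transform_comp (K : fieldType) (u r s t s' : K) V :
  transform u r s t (transform 1 0 s' 0 V) = transform u r (s + u * s') t V.
Proof. by rewrite /transform /=; congr Weierstrass; ring. Qed.

Section CharTwo.
Variable K : fieldType.
Hypothesis hchar : 2%N \in [pchar K].

Let two0 : 2%:R = 0 :> K. Proof. exact: pcharf0 hchar. Qed.
Let opp2 (x : K) : - x = x. Proof. by rewrite oppr_pchar2. Qed.

(** * Multiples of a point on y^2 + x y = x^3 + a x^2 + b *)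

Section OrdinaryCurve.
Variables a b : K.
Let W := Weierstrass 1 a 0 0 b.

Let sum_pt (l x1 y1 x2 : K) : point K :=
  let x3 := l ^+ 2 + l + a + x1 + x2 in Affine x3 (l * (x3 + x1) + x3 + y1).

Lemma add_slope_char2 l x1 y1 x2 : add_slope W l x1 y1 x2 = sum_pt l x1 y1 x2.
Proof. by rewrite /add_slope /sum_pt /= !opp2; congr Affine; ring. Qed.

Lemma add_chord x1 y1 x2 y2 l : affine_eq W x1 y1 -> affine_eq W x2 y2 ->
    x1 != x2 -> y1 + y2 = l * (x1 + x2) ->
  add W (Affine x1 y1) (Affine x2 y2) = sum_pt l x1 y1 x2.
Proof.
move=> E1 E2 ne12 el; have [|l' [A _] ->] := addP E1 E2.
  by case=> e; rewrite e eqxx in ne12.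
rewrite add_slope_char2; congr sum_pt.
have nz : x1 + x2 != 0 by rewrite -(opp2 x2) subr_eq0.
apply: (mulIf nz); rewrite -el; move: A; rewrite !opp2 => A.
by rewrite (addrC x1) -A addrC.
Qed.

Variables (x l : K).
Let X := l ^+ 2 + l + a.
Let D := X + x.
(** The tangent at (x, y) has slope x + y/x in characteristic 2, which is [l] in this
    parametrization. *)
Let P := Affine x (x * (l + x)).
Hypotheses (x0 : x != 0) (onP : on_curve W P).

Let aE : a = X - l ^+ 2 - l. Proof. by rewrite /X; ring. Qed.

Lemma double_char2 : add W P P = Affine X (x ^+ 2 + (l + 1) * X).
Proof.
rewrite [LHS](add_slopeE (l := l) onP onP).
- rewrite add_slope_char2 /sum_pt; congr Affine.
    by apply: (lincomb1 (k := x) two0); rewrite /X; ring.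
  by apply: (lincomb1 (k := (2%:R * l + 1) * x) two0); rewrite /X; ring.
- case=> /eqP; rewrite !opp2 /= mul1r addr0 -subr_eq0 => /eqP e.
  by case/eqP: x0; apply: (lincomb1 (k := -1) e); ring.
split; first by ring.
rewrite /=.
by apply: (lincomb1 (k := l ^+ 2 * x + l * x ^+ 2 + l * x - x ^+ 2 - a * x) two0); ring.
Qed.

Lemma triple_char2 : D != 0 ->
  add W P (Affine X (x ^+ 2 + (l + 1) * X))
  = let e := X * x / D ^+ 2 in
    Affine (x + e) ((l + X / D) * e + x + e + x * (l + x)).
Proof.
move=> D0; have on2 := on_curve_add onP onP; rewrite double_char2 in on2.
(* The y-coordinates of P and 2P add up to l (x + X) + X. *)
rewrite (add_chord (l := l + X / D) onP on2).
- have e3 : (l + X / D) ^+ 2 + (l + X / D) + a + x + X = x + X * x / D ^+ 2.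
    apply: (lincomb1 (k := X + l * X / D + X ^+ 2 / D ^+ 2) two0).
    by rewrite {1}aE /D; field.
  rewrite /sum_pt e3; congr Affine.
  by apply: (lincomb1 (k := (l + X / D) * x) two0); ring.
- by rewrite -subr_eq0 opp2 addrC.
apply: (lincomb1 (k := x ^+ 2) two0).
by rewrite /D; field.
Qed.

Lemma quadruple_char2 : X != 0 -> D != 0 ->
  exists y, add W P (add W P (add W P P))
    = Affine (X ^+ 2 + x ^+ 4 / X ^+ 2 + x ^+ 2 / X) y.
Proof.
move=> X0 D0; have on3 := on_curve_add onP (on_curve_add onP onP).
move: on3; rewrite double_char2 (triple_char2 D0) => on3.
set p := X / D; set q := D ^+ 2 / X; set e := X * x / D ^+ 2.
(* The x-coordinates of P and 3P differ by [e], and the y-coordinates add up to (l + p + 1) e + x,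
   where x/e = q. *)
rewrite (add_chord (l := l + p + 1 + q) onP on3).
- eexists; rewrite /sum_pt; congr Affine.
  apply: (lincomb1 (k := X + l * (p + 1 + q) + 1 + p + q + p * q + p ^+ 2 + e
    + 3%:R * x ^+ 2 + 2%:R * x * (X + x ^+ 2 / X) + 2%:R * x) two0).
  by rewrite {1}aE /p /q /e /D; field; rewrite X0 D0.
- rewrite eq_sym -subr_eq0 addrC addKr.
  by rewrite !mulf_neq0 ?invr_eq0 ?expf_neq0.
apply: (lincomb1 (k := x * (l + x) - (l + p + 1 + q) * x) two0).
by rewrite /p /q /e /D; field; rewrite X0 D0.
Qed.

End OrdinaryCurve.
Lemma order8_parameters (a b : K) (P : point K) y4 :
    on_curve (Weierstrass 1 a 0 0 b) P ->
    has_order (Weierstrass 1 a 0 0 b) P 8 ->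
    mulp (Weierstrass 1 a 0 0 b) 4 P = Affine 0 y4 ->
  exists s n : K, [/\ a = s ^+ 2 + s, n != 0, n != 1 & b = (n ^+ 2 + n) ^+ 8].
Proof.
set W := Weierstrass 1 a 0 0 b => onP [_ _ ord].
case: P onP ord => [|x y] onP ord; first by case: (ord 1%N).
have m2 : mulp W 2 (Affine x y) = add W (Affine x y) (Affine x y) by [].
have m3 : mulp W 3 (Affine x y) = add W (Affine x y) (mulp W 2 (Affine x y)) by [].
have m4 : mulp W 4 (Affine x y) = add W (Affine x y) (mulp W 3 (Affine x y)) by [].
rewrite m4 m3 m2.
(* The degenerate cases contradict order 8: x = 0 gives P = -P, X = x gives 2P = -P, and X = 0 gives
   3P = -P. *)
have x0 : x != 0.
  apply/eqP => x0; case: (ord 2%N) => //; rewrite m2 -[RHS](add_opp W x y).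
  by congr (add W _ (Affine _ _)); rewrite /= x0 !opp2; ring.
have [l ey] : exists l, y = x * (l + x).
  exists (y / x - x); field; exact: x0.
rewrite {}ey in onP ord m2 m3 m4 *; pose X := l ^+ 2 + l + a.
have E2 := double_char2 x0 onP; rewrite -/W -/X in E2.
have D0 : X + x != 0.
  apply/eqP => D0; case: (ord 3%N) => //; rewrite m3 m2.
  have Xx : X = x by rewrite -(opp2 x); apply/eqP; rewrite -addr_eq0 D0.
  rewrite E2 Xx -[RHS](add_opp W x (x * (l + x))).
  by congr (add W _ (Affine _ _)); rewrite /= !opp2; ring.
have E3 := triple_char2 x0 onP D0; rewrite -/W -/X in E3.
have X0 : X != 0.
  apply/eqP => X0; case: (ord 4%N) => //; rewrite m4 m3 m2.
  rewrite E2 E3 -[RHS](add_opp W x (x * (l + x))) X0 /opp.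
  by congr (add W _ (Affine _ _)); rewrite ?opp2 !mul0r ?mulr0 ?addr0 ?add0r //=; ring.
have [y' ->] := quadruple_char2 x0 onP X0 D0; case=> E4 _.
(* The equation x(4P) = 0 makes both v^2 + v and w^2 equal to [X]. Adding them gives n^2 + n = w,
   while a = X + l^2 + l becomes (v + l)^2 + (v + l). *)
pose w := (X + x) ^+ 2 / x; pose v := X + x ^+ 2 / X; pose n := v + w.
have w0 : w != 0 by rewrite mulf_neq0 ?invr_eq0 ?expf_neq0.
have {}E4 : X ^+ 2 + x ^+ 4 / X ^+ 2 + x ^+ 2 / X = 0 := E4.
have v2 : v ^+ 2 + v = X.
  by apply: (lincomb2 (k := 1) (k' := x ^+ 2) E4 two0); rewrite /v; field.
have w2 : w ^+ 2 = X.
  apply: (lincomb2 (k := X ^+ 2 / x ^+ 2) (k' := (2%:R * X ^+ 3 + 3%:R * X ^+ 2 * x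
    + 2%:R * X * x ^+ 2 - X * x) / x) E4 two0).
  by rewrite /w; field; rewrite x0 X0.
have nw : n ^+ 2 + n = w.
  have -> : n ^+ 2 + n = (v ^+ 2 + v) + w ^+ 2 + w + 2%:R * (v * w) by rewrite /n; ring.
  by rewrite v2 w2 two0; apply: (lincomb1 (k := X) two0); ring.
exists (v + l), n; split.
- have -> : (v + l) ^+ 2 + (v + l)
      = (v ^+ 2 + v) + (l ^+ 2 + l) + 2%:R * (v * l) by ring.
  by rewrite v2; apply: (lincomb1 (k := - (l ^+ 2 + l) - v * l) two0); rewrite /X; ring.
- by apply: contraNneq w0 => n0; rewrite -nw n0 expr0n addr0.
- by apply: contraNneq w0 => n1; rewrite -nw n1 expr1n -mulr2n two0.
have X4 : X ^+ 4 = x ^+ 4 + x ^+ 2 * X.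
  apply: (lincomb2 (k := X ^+ 2) (k' := - (x ^+ 4 + x ^+ 2 * X)) E4 two0).
  by field.
have eb : b = x ^+ 4 + x ^+ 2 * X.
  move: onP; rewrite /= /affine_eq /= => e.
  apply: (lincomb2 (k := -1) (k' := x ^+ 2 * (l ^+ 2 + l + l * x - X)) e two0).
  by rewrite /X; ring.
by rewrite nw eb -X4 -w2 -exprM.
Qed.

Lemma order8_point (m : K) : m != 0 -> m != 1 ->
  let W := Weierstrass 1 0 0 0 ((m ^+ 2 + m) ^+ 8) in
  exists2 P, on_curve W P & has_order W P 8.
Proof.
(* This inverts the formulas of [order8_parameters] for s = 0 and n = m: there v = l = m^2 and X =
   w^2, so x^2 = X (v + X) = (w m^2)^2. *)
move=> m0 m1 W; pose w := m ^+ 2 + m; pose x := w * m ^+ 2.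
have w0 : w != 0.
  rewrite /w expr2 -{3}[m]mulr1 -mulrDr mulf_neq0 //.
  by rewrite -(opp2 1) subr_eq0.
have x0 : x != 0 by rewrite mulf_neq0 ?expf_neq0.
pose P := Affine x (x * (m ^+ 2 + x)).
have onP : on_curve W P.
  rewrite /= /affine_eq /=; apply: (lincomb1 (k := m ^+ 2 * x ^+ 3 - m ^+ 3 * x ^+ 2
    - 2%:R * w ^+ 6 * m ^+ 3 + w ^+ 4 * m ^+ 6) two0).
  by rewrite /x /w; ring.
have ns : nonsingular W.
  move=> x' y'; rewrite /affine_eq /= => e.
  have [x'0|x'0] := eqVneq x' 0; last first.
    by right; rewrite two0 mul0r add0r mul1r addr0.
  left; apply: contra (expf_neq0 8 w0) => /eqP y'0; rewrite x'0 in e y'0.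
  have {}y'0 : y' = 0 by rewrite -y'0; ring.
  by rewrite y'0 in e; apply/eqP; apply: (lincomb1 (k := -1) e); rewrite /w; ring.
have w2 : (m ^+ 2) ^+ 2 + m ^+ 2 + 0 = w ^+ 2.
  by apply: (lincomb1 (k := - m ^+ 3) two0); rewrite /w; ring.
have X0 : (m ^+ 2) ^+ 2 + m ^+ 2 + 0 != 0 by rewrite w2 expf_neq0.
have D0 : (m ^+ 2) ^+ 2 + m ^+ 2 + 0 + x != 0.
  have -> : (m ^+ 2) ^+ 2 + m ^+ 2 + 0 + x = w * m.
    by apply: (lincomb1 (k := m ^+ 4) two0); rewrite /x /w; ring.
  by rewrite mulf_neq0.
have E2 := double_char2 x0 onP; have E3 := triple_char2 x0 onP D0.
have [y E4] := quadruple_char2 x0 onP X0 D0.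
have {}E4 : mulp W 4 P = Affine 0 y.
  rewrite [LHS]E4; congr Affine; rewrite w2.
  apply: (lincomb1 (k := m ^+ 8 + m ^+ 4 + 3%:R * m ^+ 6
    + 2%:R * m ^+ 3 * (m ^+ 4 + m ^+ 2)) two0).
  have -> : w ^+ 2 ^+ 2 + x ^+ 4 / (w ^+ 2) ^+ 2 + x ^+ 2 / w ^+ 2
      = w ^+ 4 + m ^+ 8 + m ^+ 4 by rewrite /x; field.
  by rewrite /w; ring.
(* Since 4P = -4P, reflection gives 8P = 0 and turns the multiples 5P, 6P, 7P into the negatives of
   3P, 2P, P. *)
have E4' : mulp W 4 P = opp W (mulp W 4 P).
  by rewrite E4 /= mulr0 !subr0 opp2.
have lt5 j : (0 < j <= 4)%N -> mulp W j P <> Infinity.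
  case: j => [|[|[|[|[|j]]]]] //= _; last by rewrite -[X in X = _]/(mulp W 4 P) E4.
    by rewrite -[X in X = _]/(add W P P) E2.
  by rewrite -[X in X = _]/(add W P (add W P P)) E2 E3.
exists P => //; split=> [//||k /andP[k0 k8]].
  by apply: (can_inj (oppK W)); rewrite -(mulp_reflect ns onP E4' (leqnn 4)).
have [k4|k4] := leqP k 4; first by apply: lt5; rewrite k0.
have le4 : (k - 4 <= 4)%N by lia.
move=> ek; apply: (lt5 (4 - (k - 4))%N); first by lia.
by rewrite (mulp_reflect ns onP E4' le4) subnKC ?ek // ltnW.
Qed.

(* After base change along Frobenius, a curve with a1 = a3 = 0 acquires the
   singular point (a4, a2 a4 + a6). *)
Lemma elliptic_a1_a3 (E : weierstrass K) : is_elliptic E -> a1 E = 0 -> a3 E != 0.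
Proof.
move=> hE a10; apply/eqP => a30.
have := hE K (pFrobenius_aut hchar) (a4 E) (a2 E * a4 E + a6 E).
rewrite /affine_eq /= !pFrobenius_autE a10 a30 two0 => -[||/eqP].
- by apply: (lincomb1 (k := a2 E * a4 E * a6 E - a4 E ^+ 3) two0); ring.
- by case/eqP; apply: (lincomb1 (k := - 2%:R * a4 E ^+ 2) two0); ring.
- by case; ring.
Qed.

(** Here [u] scales [a1] to 1, [r] removes [a3] and [t] removes [a4]; the parameters a and b are
    then read off from [a2] and [a6]. *)
Lemma ordinary_normal_form (E : weierstrass K) : a1 E != 0 ->
  exists u r s t a b, u != 0 /\ E = transform u r s t (Weierstrass 1 a 0 0 b).
Proof.
case: E => A1 A2 A3 A4 A6 /= u0; set r := A3 / A1; set t := (A4 + r ^+ 2) / A1.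
exists A1, r, 0, t, ((A2 + 3%:R * r) / A1 ^+ 2),
  ((A6 + r * A4 + r ^+ 2 * A2 + r ^+ 3 - t * A3 - t ^+ 2 - r * t * A1) / A1 ^+ 6).
split=> //; rewrite /transform /=.
have e1 : A1 = A1 * 1 - 2%:R * 0 by ring.
have e2 : A2 = A1 ^+ 2 * ((A2 + 3%:R * r) / A1 ^+ 2) + 0 * A1 - 3%:R * r + 0 ^+ 2.
  by field.
have e3 : A3 = A1 ^+ 3 * 0 - r * A1 - 2%:R * t.
  by apply: (lincomb1 (k := A3 + t) two0); rewrite /r; field.
have e4 : A4 = A1 ^+ 4 * 0 + 0 * A3 - 2%:R * r * A2 + (t + r * 0) * A1
    - 3%:R * r ^+ 2 + 2%:R * 0 * t.
  by apply: (lincomb1 (k := r * A2 + r ^+ 2) two0); rewrite /t; field.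
by rewrite -e1 -e2 -e3 -e4; congr Weierstrass; field.
Qed.

End CharTwo.

Theorem theorem10p6 (K : fieldType) (hchar : 2%N \in [pchar K])
    (E : weierstrass K) (hE : is_elliptic E) :
  (exists P : point K, on_curve E P /\ has_order E P 8)
  <-> (exists t : K, [/\ t != 0, t != 1 & isomorphic E (E8 t)]).
Proof.
have two0 : 2%:R = 0 :> K by exact: pcharf0 hchar.
have sq1 (t : K) : t ^+ 2 + 1 = (t + 1) ^+ 2.
  by apply: (lincomb1 (k := - t) two0); ring.
split=> [[P [onP ordP]]|[t [t0 t1 /isomorphic_transformed[u [r [s [t' [u0 eE]]]]]]]].
  have ns : nonsingular E by move=> x y; apply: (hE K idfun).
  have [_ m8 ord] := ordP.
  have m4 : mulp E 4 P = opp E (mulp E 4 P).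
    by rewrite -(mulp_reflect (m := 0) (k := 4) ns onP m8).
  have a1_neq0 : a1 E != 0.
    (* If [a1] vanished, 4P = -4P at an affine point would force [a3] to vanish as well. *)
    apply/eqP => a10; case/eqP: (elliptic_a1_a3 hchar hE a10).
    move: m4 (ord 4%N isT); case: (mulp E 4 P) => // x4 y4 [e] _.
    by apply: (lincomb2 (k := 1) (k' := - y4) e two0); rewrite a10; ring.
  have [u [r [s [t [a [b [u0 eE]]]]]]] := ordinary_normal_form hchar a1_neq0.
  pose Q := untransform_pt u r s t P; pose W := Weierstrass 1 a 0 0 b.
  have fQ : transform_pt u r s t Q = P by apply: untransform_ptK.
  rewrite eE -fQ in onP ordP m4.
  have onQ := (on_curve_transform r s t u0 W Q).1 onP.
  have ordQ := (transform_has_order r s t u0 8 onQ).1 ordP.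
  have : mulp W 4 Q = opp W (mulp W 4 Q).
    apply: (can_inj (transform_ptK r s t u0)).
    by rewrite transform_opp !transform_mulp.
  have [_ _ /(_ 4%N isT)] := ordQ.
  case eQ : (mulp W 4 Q) => [//|x4 y4] _ [e].
  have x40 : x4 = 0 by apply: (lincomb2 (k := 1) (k' := - y4) e two0); ring.
  rewrite x40 in eQ.
  have [s' [n [ea n0 n1 eb]]] := order8_parameters hchar onQ ordQ eQ.
  have nn0 : n + 1 != 0 by rewrite addr_eq0 oppr_pchar2.
  (* With t + 1 = 1/n one gets t/(t + 1)^2 = n^2 + n. The substitution with parameter [s'] then
     accounts for a = s'^2 + s'. *)
  exists (n^-1 + 1); split.
  - by rewrite -[1](mulVf n0) -{1}[n^-1]mulr1 -mulrDr mulf_neq0 ?invr_eq0 // addrC.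
  - by rewrite -subr_eq0 addrK invr_eq0.
  have -> : E = transform u r (s + u * s') t (E8 (n^-1 + 1)).
    rewrite eE -transform_comp; congr transform.
    have -> : E8 (n^-1 + 1) = Weierstrass 1 0 0 0 b.
      congr Weierstrass; rewrite eb; congr (_ ^+ 8); rewrite sq1.
      have -> : n^-1 + 1 + 1 = n^-1 by apply: (lincomb1 (k := 1) two0); ring.
      by field; rewrite ?oner_neq0 ?invr_eq0 n0.
    rewrite /transform /=; congr Weierstrass; try ring.
      by apply: (lincomb1 (k := s') two0); ring.
    by rewrite ea; apply: (lincomb1 (k := s' ^+ 2) two0); ring.
  exact: isomorphic_transform.
(* This inverts t = 1/m + 1, so that m^2 + m = t/(t + 1)^2. *)
pose m := (t + 1)^-1.
have t10 : t + 1 != 0 by rewrite addr_eq0 oppr_pchar2.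
have m0 : m != 0 by rewrite invr_eq0.
have m1 : m != 1 by rewrite invr_eq1 -subr_eq0 addrK.
have [P onP ordP] := order8_point hchar m0 m1.
have eE8 : E8 t = Weierstrass 1 0 0 0 ((m ^+ 2 + m) ^+ 8).
  congr Weierstrass; congr (_ ^+ 8); rewrite sq1.
  by apply: (lincomb1 (k := - (t + 1) ^- 2) two0); rewrite /m; field.
rewrite -eE8 in onP ordP.
exists (transform_pt u r s t' P); rewrite eE; split.
  exact/on_curve_transform.
exact/transform_has_order.
Qed.
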